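(* Let $X$ be a set, let $F=F_X$ be the free group on the basis $X$, let $R$ be a unital commutative ring, and let $e$ be a binomial multiplicatively descending map. Then for every integer $n\ge 1$, \[ \prod_{i=1}^n(F^{(i,0)})^{e(n,i)}\subseteq F\cap(1+\mathfrak{c}_R^{(e,n)})\subseteq\mu_R^{-1}(1+\mathfrak{d}_R^{(e,n)}). \] Moreover, when $R=\mathbb{Z}$, these inclusions are equalities.
   Context: A map $e\colon\{(n,i)\in\mathbb{Z}^2 \mid 1\le i\le n\}\to\mathbb{Z}_{\ge0}$ is called multiplicatively descending if (i) $e(n,n)=1$ for every $n$; and (ii) $e(n,i)\in e(n,i+1)\mathbb{Z}$ for every $1\le i<n$. It is called binomial if, moreover, for all positive integers $n,i,l$ with $l\le e(n,i)$ and $il\le n$ one has $\binom{e(n,i)}{l}\in e(n,il)\mathbb{Z}$. For a group $G$, the lower central filtration is $G^{(1,0)}=G$, $G^{(n+1,0)}=[G^{(n,0)},G]$ for $n\ge1$. For a subgroup $H$ and an integer $a\ge0$, $H^a$ denotes the subgroup generated by all $a$-th powers of elements of $H$. $R\langle X\rangle$ is the free associative $R$-algebra on $X$ (non-commuting polynomials), graded by total degree with homogeneous components $R\langle X\rangle^{(n)}$, and $R\langle\langle X\rangle\rangle=\prod_{n=0}^\infty R\langle X\rangle^{(n)}$ (for finite $X$, the ring of formal power series over $R$ in the non-commuting variables $X$). $\mathfrak{d}_R$ is the (two-sided) ideal of $R\langle\langle X\rangle\rangle$ generated by $X$. $R[F]$ is the group $R$-algebra of $F$, with $F$ identified with a subset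 of $R[F]$, and $\mathfrak{c}_R$ is its augmentation ideal (generated by all $g-1$, $g\in F$). The Magnus homomorphism $\mu_R\colon F\to R\langle\langle X\rangle\rangle^\times$ is the group homomorphism with $\mu_R(x)=1+x$ for $x\in X$ (its image lies in $1+\mathfrak{d}_R$). Finally \[ \mathfrak{c}_R^{(e,n)}=\sum_{i=1}^n e(n,i)\mathfrak{c}_R^i,\qquad \mathfrak{d}_R^{(e,n)}=\sum_{i=1}^n e(n,i)\mathfrak{d}_R^i, \] ideals of $R[F]$ and $R\langle\langle X\rangle\rangle$ respectively; $\mu_R^{-1}(1+\mathfrak{d}_R^{(e,n)})$ denotes the set of $g\in F$ with $\mu_R(g)\in 1+\mathfrak{d}_R^{(e,n)}$. *)

(* Defs.v *)
From HB Require Import structures.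
From mathcomp Require Import all_boot all_order all_algebra finmap.
From mathcomp Require Import boolp classical_sets functions cardinality.
From mathcomp Require Import monalg.

Set Implicit Arguments.
Unset Strict Implicit.
Unset Printing Implicit Defensive.

Import GRing.Theory.
Local Open Scope classical_set_scope.
Local Open Scope ring_scope.

(* Such a map is a total function [e : nat -> nat -> nat]; only the values
   [e n i] with [1 <= i <= n] are constrained or used. *)
Definition mult_descending (e : nat -> nat -> nat) : Prop :=
  (forall n : nat, (1 <= n)%N -> e n n = 1%N) /\
  (forall n i : nat, (1 <= i)%N -> (i < n)%N -> (e n i.+1 %| e n i)%N).

(* [(i * l <= n)%N] forces [(1 <= i <= n)%N], so all values are in the domain. *)
Definition binomial_map (e : nat -> nat -> nat) : Prop :=
  mult_descending e /\
  (forall n i l : nat, (0 < n)%N -> (0 < i)%N -> (0 < l)%N ->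
     (l <= e n i)%N -> (i * l <= n)%N -> (e n (i * l) %| 'C(e n i, l))%N).

Section Groups.
Variable G : groupType.
Implicit Types H K : set G.
Local Open Scope group_scope.

Definition is_subgroup H : Prop :=
  H 1 /\ (forall x y, H x -> H y -> H (x * y^-1)).

Definition gen_subgroup (S : set G) : set G := smallest is_subgroup S.

Definition comm_subgroup H K : set G :=
  gen_subgroup [set z | exists x y, [/\ H x, K y & z = [~ x, y]]].

(* [lower_central n] is G^(n,0) for n >= 1; the value at 0 is never used. *)
Fixpoint lower_central (n : nat) : set G :=
  match n with
  | 0 | 1 => setT
  | m.+1 => comm_subgroup (lower_central m) setT
  end.

Definition power_subgroup H (a : nat) : set G :=
  gen_subgroup [set h ^+ a | h in H].

(* The set of all products [g 1 * ... * g n], in this order, where [g i] lies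
   in (G^(i,0))^(e(n,i)). *)
Definition lower_central_prod (e : nat -> nat -> nat) (n : nat) : set G :=
  [set \prod_(1 <= i < n.+1) g i | g in
    [set g : nat -> G | forall i, (1 <= i <= n)%N ->
       power_subgroup (lower_central i) (e n i) (g i)]].

End Groups.
Arguments lower_central_prod G%_type_scope e n : clear implicits.

Section Ideals.
Variable A : pzRingType.
Implicit Types I J : set A.

(* Closure under opposites follows by multiplying by -1. *)
Definition is_ideal I : Prop :=
  [/\ I 0, (forall x y, I x -> I y -> I (x + y)),
      (forall a x, I x -> I (a * x)) & (forall a x, I x -> I (x * a))].

Definition gen_ideal (S : set A) : set A := smallest is_ideal S.

Definition ideal_mul I J : set A :=
  gen_ideal [set z | exists x y, [/\ I x, J y & z = x * y]].

Definition ideal_exp I (k : nat) : set A := iter k (ideal_mul I) setT.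

(* The sum of the ideals e(n,i) I^i, 1 <= i <= n; elements of e(n,i) I^i are
   the multiples [b i *+ e n i] with [b i] in I^i. *)
Definition ideal_filt I (e : nat -> nat -> nat) (n : nat) : set A :=
  [set \sum_(1 <= i < n.+1) b i *+ e n i | b in
    [set b : nat -> A | forall i, (1 <= i <= n)%N -> ideal_exp I i (b i)]].

End Ideals.

Section FreeGroup.
Variable X : choiceType.

(* The letter [(x, true)] stands for x and [(x, false)] for its inverse. *)
Definition letter := (X * bool)%type.
Definition inv_letter (l : letter) : letter := (l.1, ~~ l.2).
Definition reduced (w : seq letter) : bool :=
  sorted (fun l m => m != inv_letter l) w.

Record free_group := FreeGroup { fg_word :> seq letter; _ : reduced fg_word }.

HB.instance Definition _ := [isSub for fg_word].
HB.instance Definition _ := [Choice of free_group by <:].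

Definition push (l : letter) (w : seq letter) : seq letter :=
  if w is m :: w' then if m == inv_letter l then w' else l :: w else [:: l].
Definition word_mul (u v : seq letter) : seq letter := foldr push v u.
Definition word_inv (u : seq letter) : seq letter := rev (map inv_letter u).

Lemma inv_letterK : involutive inv_letter.
Proof. by case=> x b; rewrite /inv_letter /= negbK. Qed.

Lemma reduced_behead l w : reduced (l :: w) -> reduced w.
Proof. by case: w => //= m w /andP[]. Qed.

Lemma push_reduced l w : reduced w -> reduced (push l w).
Proof.
case: w => //= m w rw; case: ifPn => [_|ml]; last by rewrite /= ml.
exact: (reduced_behead rw).
Qed.

Lemma push_cons l w : reduced (l :: w) -> push l w = l :: w.
Proof. by case: w => //= m w /andP[/negPf->]. Qed.

Lemma pushK l w : reduced w -> push (inv_letter l) (push l w) = w.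
Proof.
case: w => [|m w] rw /=; first by rewrite inv_letterK eqxx.
case: eqP => [mE|_]; last by rewrite /= inv_letterK eqxx.
by rewrite -mE push_cons.
Qed.

Lemma pushVK l w : reduced w -> push l (push (inv_letter l) w) = w.
Proof. by move=> /(pushK (inv_letter l)); rewrite inv_letterK. Qed.

Lemma word_mul_reduced u v : reduced v -> reduced (word_mul u v).
Proof. by move=> rv; elim: u => //= l u; apply: push_reduced. Qed.

Lemma word_inv_reduced u : reduced u -> reduced (word_inv u).
Proof.
rewrite /reduced /word_inv rev_sorted sorted_map => ru.
apply: sub_sorted ru => l m /=.
by rewrite inv_letterK; apply: contraNneq => <-.
Qed.

Lemma word_mul_push l u v : reduced u -> reduced v ->
  word_mul (push l u) v = push l (word_mul u v).
Proof.
case: u => //= m u _ rv; case: eqP => //= ->.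
by rewrite pushVK // word_mul_reduced.
Qed.

Lemma word_mulA u v w : reduced v -> reduced w ->
  word_mul u (word_mul v w) = word_mul (word_mul u v) w.
Proof.
move=> rv rw; elim: u => //= l u ->.
by rewrite word_mul_push // word_mul_reduced.
Qed.

Lemma word_mul0 u : reduced u -> word_mul u [::] = u.
Proof.
elim: u => //= l u IH ru.
by rewrite -/(word_mul u [::]) IH ?push_cons // (reduced_behead ru).
Qed.

Lemma word_mulKV u v : reduced v -> word_mul (word_inv u) (word_mul u v) = v.
Proof.
elim: u v => //= l u IH v rv.
rewrite /word_mul /word_inv /= rev_cons -cats1 foldr_cat /=.
by rewrite pushK ?word_mul_reduced //; apply: IH.
Qed.

Lemma word_invK : involutive word_inv.
Proof.
by move=> u; rewrite /word_inv map_rev revK -map_comp map_id_in // => l _ /=;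
  rewrite inv_letterK.
Qed.

Definition fg_one : free_group := @FreeGroup [::] isT.
Definition fg_mul (u v : free_group) : free_group :=
  FreeGroup (word_mul_reduced u (valP v)).
Definition fg_inv (u : free_group) : free_group :=
  FreeGroup (word_inv_reduced (valP u)).

Lemma fg_mulA : associative fg_mul.
Proof. by move=> u v w; apply: val_inj; apply: word_mulA; apply: valP. Qed.
Lemma fg_mul1 : left_id fg_one fg_mul.
Proof. by move=> u; apply: val_inj. Qed.
Lemma fg_mulr1 : right_id fg_one fg_mul.
Proof. by move=> u; apply: val_inj; apply: word_mul0; apply: valP. Qed.
Lemma fg_mulV : left_inverse fg_one fg_inv fg_mul.
Proof.
move=> u; apply: val_inj => /=.
by rewrite -[X in word_mul _ X](word_mul0 (valP u)) word_mulKV.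
Qed.
Lemma fg_mulrV : right_inverse fg_one fg_inv fg_mul.
Proof.
move=> u; rewrite -[X in fg_mul X _](_ : fg_inv (fg_inv u) = u) ?fg_mulV //.
by apply: val_inj; apply: word_invK.
Qed.

HB.instance Definition _ :=
  isGroup.Build free_group fg_mulA fg_mul1 fg_mulr1 fg_mulV fg_mulrV.

Definition fg_gen (x : X) : free_group := @FreeGroup [:: (x, true)] isT.

Section BigWord.
Variables (T : Type) (idx : T) (op : Monoid.law idx) (f : letter -> T).
Hypothesis f_inv : forall l, op (f l) (f (inv_letter l)) = idx.

Lemma big_push l w :
  \big[op/idx]_(m <- push l w) f m = op (f l) (\big[op/idx]_(m <- w) f m).
Proof.
case: w => [|k w] /=; first by rewrite big_seq1 big_nil Monoid.mulm1.
case: eqP => [->|_]; last by rewrite !big_cons.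
rewrite big_cons; set b := bigop _ _ _.
by have := congr1 (op^~ b) (f_inv l); rewrite /= -Monoid.mulmA Monoid.mul1m.
Qed.

Lemma big_word_mul u v : \big[op/idx]_(m <- word_mul u v) f m =
  op (\big[op/idx]_(m <- u) f m) (\big[op/idx]_(m <- v) f m).
Proof.
elim: u => [|l u IH] /=; first by rewrite big_nil Monoid.mul1m.
by rewrite big_push -/(word_mul u v) IH big_cons Monoid.mulmA.
Qed.
End BigWord.

Lemma fg_letter (l : letter) :
  (if l.2 then fg_gen l.1 else (fg_gen l.1)^-1)%g = [:: l] :> seq letter.
Proof. by case: l => x []. Qed.

Lemma fg_prodE (g : free_group) :
  g = (\prod_(l <- fg_word g)
         (if l.2 then fg_gen l.1 else (fg_gen l.1)^-1))%g.
Proof.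
case: g => w rw; apply: val_inj => /=; elim: w rw => [|l w IH] rw.
  by rewrite big_nil.
rewrite big_cons -[RHS]/(word_mul _ _) fg_letter /=.
by rewrite -IH ?push_cons // (reduced_behead rw).
Qed.

Lemma fg_universal (G : groupType) (f : X -> G) :
  exists phi : free_group -> G,
    [/\ {morph phi : x y / (x * y)%g}, (forall x, phi (fg_gen x) = f x) &
        forall psi : free_group -> G, {morph psi : x y / (x * y)%g} ->
          (forall x, psi (fg_gen x) = f x) -> psi = phi].
Proof.
pose fl (l : letter) := (if l.2 then f l.1 else (f l.1)^-1)%g.
exists (fun g => (\prod_(l <- fg_word g) fl l)%g); split.
- move=> u v; apply: big_word_mul => -[x []] /=; first exact: mulgV.
  exact: mulVg.
- by move=> x; rewrite big_seq1.
move=> psi psiM psiX.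
have psi1 : psi 1%g = 1%g.
  by apply: (mulgI (psi 1%g)); rewrite -psiM !mulg1.
have psiV u : psi u^-1%g = (psi u)^-1%g.
  by apply: (mulgI (psi u)); rewrite -psiM !mulgV.
apply/funext => g; rewrite {1}[g]fg_prodE (big_morph psi psiM psi1).
by apply: eq_bigr => -[x []] _; rewrite /fl /= ?psiV psiX.
Qed.

End FreeGroup.

Section GroupAlgebra.
Variables (R : pzRingType) (G : groupType).

Definition group_algebra : Type := {malg R[G]}.
HB.instance Definition _ := GRing.Zmodule.copy group_algebra {malg R[G]}.

Implicit Types a b c : group_algebra.

Definition galg_of (g : G) : group_algebra := << 1 *g g >>.

Definition galg_mul a b : group_algebra :=
  \sum_(g <- msupp a) \sum_(h <- msupp b) << a@_g * b@_h *g (g * h)%g >>.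

Lemma galg_mulw (d1 d2 : {fset G}) a b :
  (msupp a `<=` d1)%fset -> (msupp b `<=` d2)%fset ->
  galg_mul a b = \sum_(g <- d1) \sum_(h <- d2) << a@_g * b@_h *g (g * h)%g >>.
Proof.
move=> le_d1 le_d2; rewrite /galg_mul (big_fset_incl _ le_d1) /=.
  apply/eq_bigr=> k1 _; apply/big_fset_incl => // k _ /mcoeff_outdom ->.
  by rewrite mulr0 monalgU0.
move=> k _ /mcoeff_outdom g1k.
by rewrite big1 => // k' _; rewrite g1k mul0r monalgU0.
Qed.

Lemma galg_mulUU (r s : R) (g h : G) :
  galg_mul << r *g g >> << s *g h >> = << r * s *g (g * h)%g >>.
Proof. by rewrite (galg_mulw msuppU_le msuppU_le) !big_seq_fset1 !mcoeffUU. Qed.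

Lemma galg_mulDl : left_distributive galg_mul +%R.
Proof.
move=> a b c; pose d := (msupp a `|` msupp b)%fset.
rewrite (@galg_mulw d (msupp c) (a + b)) ?msuppD_le //.
rewrite (@galg_mulw d (msupp c) a) ?fsubsetUl //.
rewrite (@galg_mulw d (msupp c) b) ?fsubsetUr //.
rewrite -big_split /=; apply/eq_bigr=> k1 _.
rewrite -big_split /=; apply/eq_bigr=> k2 _.
by rewrite mcoeffD mulrDl monalgUD.
Qed.

Lemma galg_mulDr : right_distributive galg_mul +%R.
Proof.
move=> c a b; pose d := (msupp a `|` msupp b)%fset.
rewrite (@galg_mulw (msupp c) d c (a + b)) ?msuppD_le //.
rewrite (@galg_mulw (msupp c) d c a) ?fsubsetUl //.
rewrite (@galg_mulw (msupp c) d c b) ?fsubsetUr //.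
rewrite -big_split /=; apply/eq_bigr=> k1 _.
rewrite -big_split /=; apply/eq_bigr=> k2 _.
by rewrite mcoeffD mulrDr monalgUD.
Qed.

Lemma galg_mul0 : left_zero 0 galg_mul.
Proof. by move=> a; rewrite /galg_mul msupp0 big_seq_fset0. Qed.
Lemma galg_mulr0 : right_zero 0 galg_mul.
Proof.
by move=> a; rewrite /galg_mul msupp0 big1 // => g _; rewrite big_seq_fset0.
Qed.

Lemma galg_mul_suml (I : Type) (s : seq I) (F : I -> group_algebra) b :
  galg_mul (\sum_(i <- s) F i) b = \sum_(i <- s) galg_mul (F i) b.
Proof.
exact: (big_morph (galg_mul^~ b) (fun _ _ => galg_mulDl _ _ _) (galg_mul0 _)).
Qed.
Lemma galg_mul_sumr (I : Type) (s : seq I) (F : I -> group_algebra) a :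
  galg_mul a (\sum_(i <- s) F i) = \sum_(i <- s) galg_mul a (F i).
Proof.
exact: (big_morph (galg_mul a) (fun _ _ => galg_mulDr _ _ _) (galg_mulr0 _)).
Qed.

Lemma galgE a : a = \sum_(g <- msupp a) (<< a@_g *g g >> : group_algebra).
Proof. exact: monalgE. Qed.

Lemma galg_mulA : associative galg_mul.
Proof.
move=> a b c; rewrite [a]galgE !galg_mul_suml; apply: eq_bigr => g _.
rewrite [b]galgE galg_mul_suml !galg_mul_sumr galg_mul_suml.
apply: eq_bigr => h _; rewrite [c]galgE !galg_mul_sumr.
by apply: eq_bigr => k _; rewrite !galg_mulUU mulrA mulgA.
Qed.

Lemma galg_mul1 : left_id (galg_of 1%g) galg_mul.
Proof.
move=> a; rewrite [a]galgE galg_mul_sumr; apply: eq_bigr => g _.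
by rewrite galg_mulUU mul1r mul1g.
Qed.
Lemma galg_mulr1 : right_id (galg_of 1%g) galg_mul.
Proof.
move=> a; rewrite [a]galgE galg_mul_suml; apply: eq_bigr => g _.
by rewrite galg_mulUU mulr1 mulg1.
Qed.

HB.instance Definition _ := GRing.Zmodule_isPzRing.Build group_algebra
  galg_mulA galg_mul1 galg_mulr1 galg_mulDl galg_mulDr.

Lemma galg_ofM : {morph galg_of : g h / (g * h)%g >-> g * h}.
Proof. by move=> g h; rewrite -[RHS]/(galg_mul _ _) galg_mulUU mulr1. Qed.

Definition aug_ideal : set group_algebra :=
  gen_ideal [set galg_of g - 1 | g in [set: G]].

End GroupAlgebra.

Section Series.
Variables (R : pzRingType) (X : choiceType).

(* An element of the product of the homogeneous components of R<X> is given by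
   its coefficients on all words, subject to finiteness of the support in each
   degree; that condition is automatic when X is finite, but not otherwise. *)
Record ncseries := NCSeries {
  ncoef :> seq X -> R;
  ncoef_finite : forall n, finite_set [set w | size w = n /\ ncoef w != 0]
}.

HB.instance Definition _ := gen_eqMixin ncseries.
HB.instance Definition _ := gen_choiceMixin ncseries.

Implicit Types s t u : ncseries.

Lemma ncseriesP s t : (forall w, s w = t w) -> s = t.
Proof.
case: s t => [f hf] [g hg] /= /funext fg; case: _ / fg in hg *.
by rewrite (Prop_irrelevance hf hg).
Qed.

Definition conv (f g : seq X -> R) (w : seq X) : R :=
  \sum_(i < (size w).+1) f (take i w) * g (drop i w).

Lemma ncs_zero_finite n :
  finite_set [set w : seq X | size w = n /\ (0 : R) != 0].
Proof. by apply: (sub_finite_set _ (finite_set0 _)) => w [_]; rewrite eqxx. Qed.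
Lemma ncs_one_finite n :
  finite_set [set w : seq X | size w = n /\ (w == [::])%:R != 0 :> R].
Proof.
apply: (sub_finite_set _ (finite_set1 [::])) => w [_] /=.
by case: (w =P [::]) => //; rewrite eqxx.
Qed.
Lemma ncs_opp_finite s n : finite_set [set w | size w = n /\ - s w != 0].
Proof.
by apply: (sub_finite_set _ (ncoef_finite s n)) => w [wn]; rewrite oppr_eq0.
Qed.
Lemma ncs_add_finite s t n : finite_set [set w | size w = n /\ s w + t w != 0].
Proof.
apply: (@sub_finite_set _ _
  ([set w | size w = n /\ s w != 0] `|` [set w | size w = n /\ t w != 0])).
  move=> w [wn nz] /=; have [sw0|sw] := eqVneq (s w) 0; last by left.
  by right; split=> //; move: nz; rewrite sw0 add0r.
by rewrite finite_setU; split; apply: ncoef_finite.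
Qed.
Lemma ncs_mul_finite s t n : finite_set [set w | size w = n /\ conv s t w != 0].
Proof.
apply: (@sub_finite_set _ _ (\bigcup_(i in `I_n.+1)
  [set u ++ v | u in [set u | size u = i /\ s u != 0] &
                v in [set v | size v = (n - i)%N /\ t v != 0]])).
  move=> w [wn nz].
  have /existsP[i nzi] : [exists i : 'I_(size w).+1,
      s (take i w) * t (drop i w) != 0].
    apply: contraNT nz; rewrite negb_exists => /forallP z.
    by rewrite /conv big1 // => i _; apply/eqP; rewrite -[_ == _]negbK z.
  have le_in : (i <= size w)%N by rewrite -ltnS.
  exists i => /=; first by rewrite -wn ltn_ord.
  exists (take i w); first split.
  - by rewrite size_take_min; apply/minn_idPl.
  - by apply: contra_neq nzi => ->; rewrite mul0r.
  exists (drop i w); last by rewrite cat_take_drop.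
  split; first by rewrite size_drop; congr (_ - _)%N.
  by apply: contra_neq nzi => ->; rewrite mulr0.
apply: bigcup_finite; first exact: finite_II.
by move=> i _; apply: finite_image2; apply: ncoef_finite.
Qed.

Definition ncs_zero : ncseries := NCSeries ncs_zero_finite.
Definition ncs_one : ncseries := NCSeries ncs_one_finite.
Definition ncs_opp s : ncseries := NCSeries (ncs_opp_finite s).
Definition ncs_add s t : ncseries := NCSeries (ncs_add_finite s t).
Definition ncs_mul s t : ncseries := NCSeries (ncs_mul_finite s t).

Lemma ncs_addA : associative ncs_add.
Proof. by move=> s t u; apply: ncseriesP => w; apply: addrA. Qed.
Lemma ncs_addC : commutative ncs_add.
Proof. by move=> s t; apply: ncseriesP => w; apply: addrC. Qed.
Lemma ncs_add0 : left_id ncs_zero ncs_add.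
Proof. by move=> s; apply: ncseriesP => w; apply: add0r. Qed.
Lemma ncs_addN : left_inverse ncs_zero ncs_opp ncs_add.
Proof. by move=> s; apply: ncseriesP => w; apply: addNr. Qed.

HB.instance Definition _ :=
  GRing.isZmodule.Build ncseries ncs_addA ncs_addC ncs_add0 ncs_addN.

Lemma conv_nil f g : conv f g [::] = f [::] * g [::].
Proof. by rewrite /conv big_ord1. Qed.

Lemma conv_cons f g x w :
  conv f g (x :: w) = f [::] * g (x :: w) + conv (fun v => f (x :: v)) g w.
Proof. by rewrite /conv big_ord_recl. Qed.

Lemma conv_Dl f g h w : conv (fun v => f v + g v) h w = conv f h w + conv g h w.
Proof. by rewrite /conv -big_split; apply: eq_bigr => i _; apply: mulrDl. Qed.

Lemma conv_Dr f g h w : conv f (fun v => g v + h v) w = conv f g w + conv f h w.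
Proof. by rewrite /conv -big_split; apply: eq_bigr => i _; apply: mulrDr. Qed.

Lemma conv_Zl c f g w : conv (fun v => c * f v) g w = c * conv f g w.
Proof. by rewrite /conv mulr_sumr; apply: eq_bigr => i _; rewrite mulrA. Qed.

Lemma conv_0l f g w : (forall v, f v = 0) -> conv f g w = 0.
Proof. by move=> f0; rewrite /conv big1 // => i _; rewrite f0 mul0r. Qed.

Lemma convA f g h w : conv f (conv g h) w = conv (conv f g) h w.
Proof.
elim: w f g => [|x w IH] f g; first by rewrite !conv_nil mulrA.
rewrite !conv_cons conv_nil.
have -> : (fun v => conv f g (x :: v)) =
    (fun v => f [::] * g (x :: v) + conv (fun v => f (x :: v)) g v).
  by apply/funext => v; rewrite conv_cons.
by rewrite conv_Dl conv_Zl -IH mulrDr mulrA addrA.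
Qed.

Lemma ncs_mulA : associative ncs_mul.
Proof. by move=> s t u; apply: ncseriesP => w; apply: convA. Qed.

Lemma ncs_mul1 : left_id ncs_one ncs_mul.
Proof.
move=> s; apply: ncseriesP => -[|x w] /=; first by rewrite conv_nil mul1r.
by rewrite conv_cons mul1r conv_0l ?addr0.
Qed.

Lemma ncs_mulr1 : right_id ncs_one ncs_mul.
Proof.
move=> s; apply: ncseriesP => w /=; elim: w (ncoef s) => [|x w IH] f.
  by rewrite conv_nil mulr1.
by rewrite conv_cons mulr0 add0r IH.
Qed.

Lemma ncs_mulDl : left_distributive ncs_mul +%R.
Proof. by move=> s t u; apply: ncseriesP => w; apply: conv_Dl. Qed.
Lemma ncs_mulDr : right_distributive ncs_mul +%R.
Proof. by move=> s t u; apply: ncseriesP => w; apply: conv_Dr. Qed.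

HB.instance Definition _ := GRing.Zmodule_isPzRing.Build ncseries
  ncs_mulA ncs_mul1 ncs_mulr1 ncs_mulDl ncs_mulDr.

Lemma ncs_var_finite x n :
  finite_set [set w : seq X | size w = n /\ (w == [:: x])%:R != 0 :> R].
Proof.
apply: (sub_finite_set _ (finite_set1 [:: x])) => w [_] /=.
by case: (w =P [:: x]) => //; rewrite eqxx.
Qed.
Definition ncs_var x : ncseries := NCSeries (ncs_var_finite x).

Definition var_ideal : set ncseries := gen_ideal (range ncs_var).

(* The coefficient function of (1 + x)^-1, the alternating sum of the powers
   of x; see [inv1varK] and [inv1varVK]. *)
Definition inv1var_coef x (w : seq X) : R :=
  if all (pred1 x) w then (-1) ^+ size w else 0.

Lemma inv1var_finite x n :
  finite_set [set w | size w = n /\ inv1var_coef x w != 0].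
Proof.
apply: (sub_finite_set _ (finite_set1 (nseq n x))) => w [<-] /=.
by rewrite /inv1var_coef; case: ifP; rewrite ?eqxx // => /all_pred1P <-.
Qed.
Definition inv1var x : ncseries := NCSeries (inv1var_finite x).

Lemma inv1var_cons x y w :
  inv1var x (y :: w) = - (y == x)%:R * inv1var x w.
Proof.
rewrite /= /inv1var_coef /=; case: (y == x) => /=; last by rewrite oppr0 mul0r.
by case: ifP => _; rewrite ?mulr0 // exprS.
Qed.

Lemma ncs_var_cons x y w : ncs_var x (y :: w) = (y == x)%:R * (w == [::])%:R.
Proof. by rewrite /= eqseq_cons -natrM mulnb. Qed.

Lemma inv1varK x : inv1var x * (1 + ncs_var x) = 1.
Proof.
apply: ncseriesP => w; rewrite -[LHS]/(conv _ _ w).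
elim: w => [|y w IH].
  by rewrite conv_nil /= /inv1var_coef /= addr0 mulr1.
rewrite conv_cons.
have -> : (fun v => inv1var x (y :: v)) =
    (fun v => - (y == x)%:R * inv1var x v).
  by apply/funext => v; rewrite inv1var_cons.
rewrite conv_Zl IH -[(1 + ncs_var x) (y :: w)]/(0 + ncs_var x (y :: w)).
by rewrite add0r ncs_var_cons /= /inv1var_coef /= mul1r mulNr subrr.
Qed.

Lemma inv1varVK x : (1 + ncs_var x) * inv1var x = 1.
Proof.
apply: ncseriesP => -[|y w]; rewrite -[LHS]/(conv _ _ _).
  by rewrite conv_nil /= /inv1var_coef /= addr0 mulr1.
rewrite conv_cons.
have -> : (fun v => (1 + ncs_var x) (y :: v)) =
    (fun v => (y == x)%:R * (1 : ncseries) v).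
  apply/funext => v; rewrite -[LHS]/(0 + ncs_var x (y :: v)).
  by rewrite add0r ncs_var_cons.
rewrite conv_Zl -[conv (1 : ncseries) _ w]/((1 * inv1var x) w) mul1r.
by rewrite inv1var_cons /= addr0 mul1r mulNr addNr.
Qed.

Definition mu_letter (l : letter X) : ncseries :=
  if l.2 then 1 + ncs_var l.1 else inv1var l.1.

Definition magnus (g : free_group X) : ncseries :=
  \prod_(l <- fg_word g) mu_letter l.

Lemma magnus1 : magnus 1%g = 1.
Proof. by rewrite /magnus big_nil. Qed.

Lemma magnusM : {morph magnus : g h / (g * h)%g >-> g * h}.
Proof.
move=> g h; apply: big_word_mul => -[x []]; first exact: inv1varVK.
exact: inv1varK.
Qed.

Lemma magnus_gen x : magnus (fg_gen x) = 1 + ncs_var x.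
Proof. by rewrite /magnus big_seq1. Qed.

End Series.

Section Filtrations.
Variables (R : pzRingType) (X : choiceType).
Variables (e : nat -> nat -> nat) (n : nat).

(* F intersected with 1 + c_R^(e,n), where F is seen inside R[F]. *)
Definition group_algebra_filt : set (free_group X) :=
  @galg_of R (free_group X) @^-1`
    [set 1 + c | c in ideal_filt (@aug_ideal R (free_group X)) e n].

Definition magnus_filt : set (free_group X) :=
  @magnus R X @^-1` [set 1 + d | d in ideal_filt (@var_ideal R X) e n].

End Filtrations.
Arguments group_algebra_filt R X%_type_scope e n : clear implicits.
Arguments magnus_filt R X%_type_scope e n : clear implicits.

(* Main.v *)
Require Import Defs.
From mathcomp Require Import all_boot all_order all_algebra finmap.
From mathcomp Require Import boolp classical_sets cardinality.
From mathcomp Require Import monalg zify.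

(** The first two inclusions hold because [g |-> g - 1] carries the lower
central filtration into the powers of the augmentation ideal [c], as a
commutator is congruent to an additive commutator
([lower_central_filtration]). If [g = 1 + x] with [x] in the [i]-th power of
[c], then [g ^+ e n i - 1] is the sum of the terms ['C(e n i, l) x ^+ l], and
the binomial condition on [e] puts each of them into [c^(e,n)]
([binomial_filt]). The linear extension of the Magnus map to the group algebra
carries [c^(e,n)] into [d^(e,n)] ([group_algebra_filt_magnus]).

Over the integers the circle is closed by showing that an element [g] with
[mu g - 1] in [d^(e,n)] is a product of elements of the groups
[power_subgroup (lower_central i) (e n i)]. Such a [g] has its coefficients at
the words of length [i] divisible by [e n i] for [1 <= i <= n], and the
factors are split off degree by degree ([coef_dvd_lower_central_prod]). One
step of this descent asks for the following: if [h] lies in [lower_central i]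
and the form of degree [i] of [mu h] is divisible by [m], then [h] is
congruent modulo [lower_central i.+1] to an element of
[power_subgroup (lower_central i) m] ([lower_central_power]). This says that
the lower central quotient of degree [i] embeds with torsion-free cokernel
into the forms of degree [i], a theorem of Magnus and Witt.

It is proved with Lyndon words. Each Lyndon word [w] is bracketed along its
standard factorization to a commutator [lyndon_comm w] in
[lower_central (size w)]. On the one hand the lowest form of
[mu (lyndon_comm w)] is [w] plus larger words ([magnus_lyndon]). On the other
hand the Lyndon commutators of length [i] generate [lower_central i] modulo
the next term ([lower_central_lyndon]); this rests on the rewriting of the
bracket of two Lyndon commutators by means of the Jacobi identity
([lyndon_span_commg]). Together they give a triangular system with ones on the
diagonal, from which the exponents of [h] on the Lyndon commutators are
computed, and found divisible by [m]. The alphabet has to be finite and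
ordered for this; the general case follows since a retraction onto the letters
of [g] keeps the relevant coefficients ([magnus_tnth]). *)

Set Implicit Arguments.
Unset Strict Implicit.
Unset Printing Implicit Defensive.

Import Order.TTheory GRing.Theory Num.Theory.
Import Order.DefaultSeqLexiOrder.
Local Open Scope classical_set_scope.
Local Open Scope ring_scope.

(** * The lower central filtration as a graded Lie ring *)

Section LowerCentral.
Variable G : groupType.
Implicit Types (H K : set G) (a b c x y z : G).
Local Open Scope group_scope.
Local Notation gam := (@lower_central G).
Local Arguments lower_central : simpl never.

Lemma subgroup1 H : is_subgroup H -> H 1. Proof. by case. Qed.

Lemma subgroupV H : is_subgroup H -> forall x, H x -> H x^-1.
Proof. by case=> H1 HB x Hx; rewrite -[x^-1]mul1g; apply: HB. Qed.

Lemma subgroupM H : is_subgroup H -> forall x y, H x -> H y -> H (x * y).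
Proof.
by move=> sH x y Hx Hy; rewrite -[y]invgK; apply: sH.2 => //; apply: subgroupV.
Qed.

Lemma subgroupX H : is_subgroup H -> forall x k, H x -> H (x ^+ k).
Proof.
move=> sH x k Hx; elim: k => [|k IH]; first exact: subgroup1.
by rewrite expgS; apply: subgroupM.
Qed.

Lemma subgroup_gen (S : set G) : is_subgroup (gen_subgroup S).
Proof.
split=> [H [[]]//|x y Sx Sy H [sH SH]].
by apply: sH.2; [apply: Sx|apply: Sy].
Qed.

Lemma sub_gen_subgroup (S : set G) : S `<=` gen_subgroup S.
Proof. exact: sub_gen_smallest. Qed.

Lemma gen_subgroup_min (S H : set G) :
  is_subgroup H -> S `<=` H -> gen_subgroup S `<=` H.
Proof. exact: smallest_sub. Qed.

Lemma commgM_r x y z : [~ x, y * z] = [~ x, z] * [~ x, y] ^ z.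
Proof. by rewrite /commg /conjg !gnorm. Qed.

Lemma commgV_r x y : [~ x, y^-1] = ([~ x, y]^-1) ^ y^-1.
Proof. by rewrite /commg /conjg !gnorm. Qed.

(** The source of both the three subgroups argument and the Jacobi identity. *)
Lemma hall_witt x y z :
  [~ x, y^-1, z] ^ y * ([~ y, z^-1, x] ^ z * [~ z, x^-1, y] ^ x) = 1.
Proof. by rewrite /commg /conjg !gnorm. Qed.

Lemma conjg_mulR x y : x ^ y = x * [~ x, y].
Proof. by rewrite commgEl mulVKg. Qed.

Lemma lower_centralS n : (0 < n)%N ->
  gam n.+1 = comm_subgroup (gam n) setT.
Proof. by case: n. Qed.

Lemma subgroup_lower_central n : is_subgroup (gam n).
Proof. by case: n => [|[|n]] //; apply: subgroup_gen. Qed.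

Lemma commg_lower_central1 n x y : gam n x -> gam n.+1 [~ x, y].
Proof. by case: n => [|n] // nx; apply: sub_gen_subgroup; exists x, y. Qed.

Lemma lower_central_conj n x y : gam n x -> gam n (x ^ y).
Proof.
elim: n x => [|n IH] x //; case: n IH => // n IH nx.
move: x nx; apply: (@gen_subgroup_min _ [set x | gam n.+2 (x ^ y)]).
  split=> [|a b /= Ha Hb]; rewrite /= ?conj1g ?conjMg ?conjVg.
    exact: (subgroup_lower_central n.+2).1.
  exact: (subgroup_lower_central n.+2).2.
move=> _ [a [b [na _ ->]]] /=; rewrite conjRg; apply: commg_lower_central1.
exact: IH.
Qed.

Lemma lower_central_subS n : gam n.+1 `<=` gam n.
Proof.
case: n => // n; apply: gen_subgroup_min; first exact: subgroup_lower_central.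
move=> _ [a [b [na _ ->]]]; have sG := subgroup_lower_central n.+1.
rewrite commgEl; apply: subgroupM => //; first exact: subgroupV.
exact: lower_central_conj.
Qed.

(** Induction on [j], for all [i] at once: by the Hall-Witt identity a
    commutator of [[~ y, z]] and [x], with [y] in [gam j], is up to signs a
    product of conjugates of [[~ x, y, z]] and [[~ z, x, y]], to which the
    induction hypothesis for [j] applies. *)
Lemma commg_lower_central i j x y :
  gam i x -> gam j y -> gam (i + j) [~ x, y].
Proof.
elim: j i x y => [|j IH] i x y ix jy.
  rewrite addn0 commgEl; have sG := subgroup_lower_central i.
  by apply: subgroupM => //; [apply: subgroupV|apply: lower_central_conj].
case: j IH jy => [|j] IH jy.
  by rewrite addn1; apply: commg_lower_central1.
have sN := subgroup_lower_central (i + j.+2).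
move: y jy x ix; apply: (@gen_subgroup_min _ [set y | forall x, gam i x -> _]).
  split=> /= [x _|y z Hy Hz x ix]; first by rewrite commg1; apply: subgroup1.
  rewrite commgM_r; apply: subgroupM => //; last first.
    by apply: lower_central_conj; apply: Hy.
  rewrite commgV_r; apply: lower_central_conj; apply: subgroupV => //.
  exact: Hz.
move=> _ [y [z [jy _ ->]]] x ix /=.
rewrite -invgR; apply: subgroupV => //.
have := hall_witt x y z^-1; rewrite invgK.
set u := _ ^ y; set w := _ ^ x => uvw1.
have {uvw1} -> : [~ y, z, x] = (u^-1 * w^-1) ^ z.
  apply: (conjg_inj z^-1); apply: (mulIg w); apply: (mulgI u).
  by rewrite uvw1 conjgK mulgVK mulgV.
apply: lower_central_conj.
have sV k := subgroupV (subgroup_lower_central k).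
apply: subgroupM => //; apply: (sV); apply: lower_central_conj.
  rewrite addnS; apply: commg_lower_central1; apply: IH => //; exact: sV.
rewrite addnS -addSn; apply: IH => //.
by rewrite -invgR; apply/sV/commg_lower_central1/sV.
Qed.

(** Commutators are bilinear modulo [gam (i + j).+1]. For a subgroup [K] above
    that term, bilinearity amounts to the elements whose commutator with [a]
    falls into [K] being closed under products and inverses; in this form no
    quotient has to be built. *)
Lemma subgroup_commg_r i j (K : set G) a : (0 < j)%N -> is_subgroup K ->
  gam (i + j).+1 `<=` K -> gam i a ->
  is_subgroup [set b | gam j b /\ K [~ a, b]].
Proof.
move=> j0 sK NK ia; have sj := subgroup_lower_central j.
split=> [|b c [jb Kb] [jc Kc]]; split => /=.
- exact: subgroup1.
- by rewrite commg1; apply: subgroup1.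
- exact: sj.2.
have conjK x y : gam (i + j) x -> K x -> K (x ^ y).
  move=> ijx Kx; rewrite conjg_mulR; apply: subgroupM => //.
  exact/NK/commg_lower_central1.
have ijV := subgroupV (subgroup_lower_central (i + j)).
rewrite commgM_r; apply: subgroupM => //.
  rewrite commgV_r; apply: conjK; last exact: subgroupV.
  exact/ijV/commg_lower_central.
by apply: conjK => //; apply: commg_lower_central.
Qed.

Lemma subgroup_commg_l i j (K : set G) b : (0 < i)%N -> is_subgroup K ->
  gam (i + j).+1 `<=` K -> gam j b ->
  is_subgroup [set a | gam i a /\ K [~ a, b]].
Proof.
move=> i0 sK NK jb.
have -> : [set a | gam i a /\ K [~ a, b]] = [set a | gam i a /\ K [~ b, a]].
  apply/seteqP; split=> a [ia Ka]; split=> //=; rewrite -invgR;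
  exact: subgroupV.
by apply: (@subgroup_commg_r j) => //; rewrite addnC.
Qed.

(** Modulo [gam (i + j + k).+1] the conjugations in the Hall-Witt identity
    disappear and inverses become signs, which leaves the Jacobi identity in
    the form of a Leibniz rule for the commutator with [z]. *)
Lemma commg_jacobi i j k (K : set G) x y z :
  (0 < i)%N -> (0 < j)%N -> (0 < k)%N -> is_subgroup K ->
  gam (i + j + k).+1 `<=` K -> gam i x -> gam j y -> gam k z ->
  K [~ x, z, y] -> K [~ x, [~ y, z]] -> K [~ x, y, z].
Proof.
move=> i0 j0 k0 sK NK ix jy kz Kxzy Kxyz.
have sV l := subgroupV (subgroup_lower_central l).
have conjK u v : gam (i + j + k) u -> K (u ^ v) <-> K u.
  move=> ijku; rewrite conjg_mulR.
  have Kuv : K [~ u, v] by exact/NK/commg_lower_central1.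
  split=> Ku; last exact: subgroupM.
  by rewrite -[u](mulgK [~ u, v]); apply: sK.2.
(* The elements that can stand as the inner commutator against [w]. *)
pose P d w := [set a | gam d a /\ K [~ a, w]].
have sP d r w : (0 < d)%N -> (d + r = i + j + k)%N -> gam r w ->
    is_subgroup (P d w).
  by move=> d0 dr rw; apply: (@subgroup_commg_l _ r) => //; rewrite dr.
(* Inside [P d w] an argument of a commutator may be inverted. *)
have signl d p q r u v w : (0 < p)%N -> (p + q = d)%N ->
    (d + r = i + j + k)%N -> gam p u -> gam q v -> gam r w ->
    P d w [~ u, v] -> P d w [~ u^-1, v].
  move=> p0 pq dr pu qv rw Puv; rewrite -pq in dr Puv *.
  have NP : gam (p + q).+1 `<=` P (p + q)%N w.
    move=> a pqa; split; first exact: lower_central_subS.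
    by apply: NK; rewrite -dr -addSn; apply: commg_lower_central.
  have sPd : is_subgroup (P (p + q)%N w).
    by apply: (sP _ r); rewrite ?addn_gt0 ?p0.
  by have [] // := subgroupV (subgroup_commg_l p0 sPd NP qv) (x := u).
have := hall_witt x y^-1 z; rewrite invgK.
set u := [~ x, y, z]; set v := _ ^ z; set w := _ ^ x => uvw1.
have Kv : K v.
  have dE : (j + k + i = i + j + k)%N by rewrite addnC addnA.
  apply/conjK.
    rewrite -dE; apply: commg_lower_central => //.
    by apply: commg_lower_central; apply: sV.
  have sPx : is_subgroup (P (j + k)%N x).
    by apply: (sP _ i); rewrite ?addn_gt0 ?j0.
  suff [] : P (j + k)%N x [~ y^-1, z^-1] by [].
  apply: (signl _ j k i) => //; first exact: sV.
  rewrite -invgR; apply: subgroupV => //.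
  apply: (signl _ k j i) => //; first exact: addnC.
  rewrite -invgR; apply: subgroupV => //.
  split; first exact: commg_lower_central.
  by rewrite -invgR; apply: subgroupV.
have Kw : K w.
  have dE : (i + k + j = i + j + k)%N by rewrite addnAC.
  have zx : gam (i + k) [~ z, x^-1].
    by rewrite addnC; apply: commg_lower_central => //; apply: sV.
  apply/conjK.
    by rewrite -dE; apply: commg_lower_central => //; apply: sV.
  have [] // := subgroupV (@subgroup_commg_r (i + k) j K _ j0 sK _ zx) (x := y).
    by rewrite dE.
  split=> //; suff [] : P (i + k)%N y [~ z, x^-1] by [].
  rewrite -invgR; apply: subgroupV.
    by apply: (sP _ j); rewrite ?addn_gt0 ?i0.
  apply: (signl _ i k j) => //; split => //.
  exact: commg_lower_central.
apply/(conjK _ y^-1).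
  by do 2!apply: commg_lower_central => //.
have -> : u ^ y^-1 = (v * w)^-1 by rewrite -(mulg1_eq uvw1) invgK.
by apply: subgroupV => //; apply: subgroupM.
Qed.
End LowerCentral.

(** * Ideal filtrations and the two general inclusions *)

Section Ideals.
Variable A : pzRingType.
Implicit Types (I J K : set A) (a b x y : A).

Lemma idealD I : is_ideal I -> forall x y, I x -> I y -> I (x + y).
Proof. by case. Qed.

Lemma idealMl I : is_ideal I -> forall a x, I x -> I (a * x).
Proof. by case. Qed.

Lemma idealMr I : is_ideal I -> forall a x, I x -> I (x * a).
Proof. by case. Qed.

Lemma idealN I : is_ideal I -> forall x, I x -> I (- x).
Proof. by move=> iI x Ix; rewrite -mulN1r; apply: idealMl. Qed.

Lemma idealB I : is_ideal I -> forall x y, I x -> I y -> I (x - y).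
Proof. by move=> iI x y Ix Iy; apply: idealD => //; apply: idealN. Qed.

Lemma ideal_sum I : is_ideal I -> forall (T : Type) (s : seq T) (P : pred T) F,
  (forall i, P i -> I (F i)) -> I (\sum_(i <- s | P i) F i).
Proof. by case=> I0 ID _ _ T s P F IF; apply: big_ind. Qed.

Lemma ideal_gen (S : set A) : is_ideal (gen_ideal S).
Proof.
split=> [J [[]]//|x y Sx Sy J [iJ SJ]|a x Sx J [iJ SJ]|a x Sx J [iJ SJ]].
- by apply: idealD => //; [apply: Sx|apply: Sy].
- by apply: idealMl => //; apply: Sx.
- by apply: idealMr => //; apply: Sx.
Qed.

Lemma sub_gen_ideal (S : set A) : S `<=` gen_ideal S.
Proof. exact: sub_gen_smallest. Qed.

Lemma gen_ideal_min (S J : set A) :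
  is_ideal J -> S `<=` J -> gen_ideal S `<=` J.
Proof. exact: smallest_sub. Qed.

Lemma ideal_ideal_exp I k : is_ideal (ideal_exp I k).
Proof. by case: k => [|k]; [|apply: ideal_gen]. Qed.

Lemma ideal_expS I k x y : I x -> ideal_exp I k y -> ideal_exp I k.+1 (x * y).
Proof. by move=> Ix Iy; apply: sub_gen_ideal; exists x, y. Qed.

Lemma ideal_exp1 I x : I x -> ideal_exp I 1 x.
Proof. by move=> Ix; rewrite -[x]mulr1; apply: ideal_expS. Qed.

(** The induction principle for membership in the powers of [I]. *)
Lemma ideal_exp_min I (J : nat -> set A) : (forall k, is_ideal (J k)) ->
  (forall x, J 0%N x) ->
  (forall k x y, I x -> J k y -> J k.+1 (x * y)) ->
  forall k, ideal_exp I k `<=` J k.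
Proof.
move=> iJ J0 JM; elim=> [|k IH] x; first by [].
apply: (gen_ideal_min (iJ k.+1)) x => _ [x [y [Ix /IH Jy ->]]]; exact: JM.
Qed.

Lemma ideal_expD I i j x y :
  ideal_exp I i x -> ideal_exp I j y -> ideal_exp I (i + j) (x * y).
Proof.
move=> ix jy; move: x ix y jy.
apply: (@ideal_exp_min I (fun i => [set x | forall y, ideal_exp I j y ->
  ideal_exp I (i + j) (x * y)])) => [k|x y|k x y Ix Hy z jz].
- have ik := ideal_ideal_exp I (k + j); have ij := ideal_ideal_exp I j.
  split=> /= [z _|x y Hx Hy z jz|a x Hx z jz|a x Hx z jz].
  + by rewrite mul0r; case: ik.
  + by rewrite mulrDl; apply: (idealD ik); [apply: Hx|apply: Hy].
  + by rewrite -mulrA; apply: (idealMl ik); apply: Hx.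
  + by rewrite -mulrA; apply: Hx; apply: (idealMl ij).
- exact: (idealMl (ideal_ideal_exp I j)).
- by rewrite -mulrA addSn; apply: ideal_expS => //; apply: Hy.
Qed.

Lemma ideal_exp_le I i j : (i <= j)%N -> ideal_exp I j `<=` ideal_exp I i.
Proof.
move=> /subnK <-; elim: (j - i)%N => // k IH x; rewrite addSn.
apply: (gen_ideal_min (ideal_ideal_exp I i)) x => _ [x [y [_ /IH iy ->]]].
exact: (idealMl (ideal_ideal_exp I i)).
Qed.

Lemma ideal_expX I i x l : ideal_exp I i x -> ideal_exp I (i * l) (x ^+ l).
Proof.
move=> ix; elim: l => [|l IH]; first by rewrite muln0.
by rewrite exprS mulnS; apply: ideal_expD.
Qed.

Section Filt.
Variables (I : set A) (e : nat -> nat -> nat) (n : nat).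

Lemma ideal_filt_ideal : is_ideal (ideal_filt I e n).
Proof.
split.
- exists (fun=> 0) => /= [i _|]; first by case: (ideal_ideal_exp I i).
  by rewrite big1 // => i _; rewrite mul0rn.
- move=> _ _ [b bI <-] [c cI <-]; exists (fun i => b i + c i) => /= [i ni|].
    by apply: (idealD (ideal_ideal_exp I i)); [apply: bI|apply: cI].
  by rewrite -big_split; apply: eq_bigr => i _; rewrite mulrnDl.
- move=> a _ [b bI <-]; exists (fun i => a * b i) => /= [i ni|].
    by apply: (idealMl (ideal_ideal_exp I i)); apply: bI.
  by rewrite mulr_sumr; apply: eq_bigr => i _; rewrite mulrnAr.
- move=> a _ [b bI <-]; exists (fun i => b i * a) => /= [i ni|].
    by apply: (idealMr (ideal_ideal_exp I i)); apply: bI.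
  by rewrite mulr_suml; apply: eq_bigr => i _; rewrite mulrnAl.
Qed.

Lemma ideal_filt_term i x : (1 <= i <= n)%N -> ideal_exp I i x ->
  ideal_filt I e n (x *+ e n i).
Proof.
move=> ni ix; exists (fun j => if j == i then x else 0) => /= [j _|].
  by case: eqP => [->//|_]; case: (ideal_ideal_exp I j).
rewrite (bigD1_seq i) ?iota_uniq ?mem_index_iota //= eqxx big1 ?addr0 //.
by move=> j /negPf->; rewrite mul0rn.
Qed.

(** Each binomial term of [(1 + x) ^+ e n i - 1] with [i * l <= n] lies in
    [e n (i * l)] times the [i * l]-th power of [I]; the other terms lie in
    the [n]-th power of [I], and [e n n = 1]. *)
Lemma binomial_filt i x : binomial_map e -> (1 <= i <= n)%N ->
  ideal_exp I i x -> ideal_filt I e n ((x + 1) ^+ e n i - 1).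
Proof.
move=> [[enn _] eb] /andP[i0 ni] ix; have iF := ideal_filt_ideal.
have n0 : (0 < n)%N by apply: leq_trans ni.
rewrite exprD1n big_ord_recl expr0 bin0 mulr1n addrC addKr.
apply: (ideal_sum iF) => -[l /= le] _; rewrite /bump add1n.
have xl := ideal_expX l.+1 ix.
have [iln|] := leqP (i * l.+1) n.
  have /dvdnP[q ->] := eb n i l.+1 n0 i0 isT le iln.
  rewrite mulrnA; apply: ideal_filt_term; first by rewrite muln_gt0 i0.
  by rewrite -mulr_natl; apply: (idealMl (ideal_ideal_exp I _)).
move=> /ltnW nil; rewrite -mulr_natl; apply: (idealMl iF).
rewrite -[_ ^+ _]mulr1n -(enn n n0).
apply: ideal_filt_term; first by rewrite n0 /=.
exact: ideal_exp_le nil _ xl.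
Qed.
End Filt.

End Ideals.

Section IdealMorphism.
Variables (A B : pzRingType) (f : A -> B).
Hypotheses (f0 : f 0 = 0) (fD : {morph f : x y / x + y})
  (fM : {morph f : x y / x * y}).

Lemma ideal_preimage (J : set B) : is_ideal J -> is_ideal (f @^-1` J).
Proof.
move=> [J0 JD JMl JMr].
split=> [|x y Jx Jy|a x Jx|a x Jx]; rewrite /preimage /mkset ?f0 ?fD ?fM //.
- exact: JD.
- exact: JMl.
- exact: JMr.
Qed.

Lemma ideal_exp_morph (I : set A) (J : set B) k : I `<=` f @^-1` J ->
  ideal_exp I k `<=` f @^-1` ideal_exp J k.
Proof.
move=> IJ; apply: (@ideal_exp_min _ I (fun k => f @^-1` ideal_exp J k)) => //.
- by move=> i; apply: ideal_preimage; apply: ideal_ideal_exp.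
- by move=> i x y /IJ Jx Jy; rewrite /preimage /mkset fM; apply: ideal_expS.
Qed.

Lemma ideal_filt_morph (I : set A) (J : set B) e n : I `<=` f @^-1` J ->
  ideal_filt I e n `<=` f @^-1` ideal_filt J e n.
Proof.
move=> IJ _ [b bI <-]; rewrite /preimage /mkset (big_morph f fD f0).
exists (f \o b) => [i ni|]; first exact/(ideal_exp_morph IJ)/bI.
apply: eq_bigr => i _ /=; elim: (e n i) => [|m IH]; first by rewrite !mulr0n f0.
by rewrite !mulrS fD IH.
Qed.
End IdealMorphism.

Section GroupsInRings.
Variables (G : groupType) (A : pzRingType) (f : G -> A).
Hypotheses (f1 : f 1%g = 1) (fM : {morph f : g h / (g * h)%g >-> g * h}).
Implicit Types g h : G.
Local Notation gam := (@lower_central G).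

Lemma morph_invK g : f g^-1%g * f g = 1.
Proof. by rewrite -fM mulVg f1. Qed.

Lemma morph_commg g h : f [~ g, h]%g - 1 = f g^-1%g * f h^-1%g *
  ((f g - 1) * (f h - 1) - (f h - 1) * (f g - 1)).
Proof.
have -> : (f g - 1) * (f h - 1) - (f h - 1) * (f g - 1) = f g * f h - f h * f g.
  have E x y : (x - 1) * (y - 1) = x * y - (x + y - 1) :> A.
    by rewrite mulrBl !mulrBr !mul1r !mulr1 -addrA -opprD addrA.
  by rewrite !E [f h + _]addrC; move: (_ - 1) => s; rewrite opprB addrA subrK.
rewrite mulrBr -[f [~ _, _]%g]/(f (g^-1 * (h^-1 * (g * h)))%g) !fM !mulrA.
congr (_ - _); rewrite -[_ * f h^-1%g * _]mulrA morph_invK mulr1 morph_invK.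
by [].
Qed.

(** The congruence subgroup of an ideal. *)
Lemma subgroup_congruence (J : set A) : is_ideal J ->
  is_subgroup [set g | J (f g - 1)].
Proof.
move=> iJ; split=> [|g h Jg Jh]; rewrite /mkset.
  by rewrite f1 subrr; case: iJ.
have -> : f (g * h^-1)%g - 1 = (f g - f h) * f h^-1%g.
  by rewrite mulrBl -!fM mulgV f1.
apply: (idealMr iJ).
have -> : f g - f h = (f g - 1) - (f h - 1) by rewrite opprB addrA subrK.
exact: idealB.
Qed.

(** A filtration by ideals turns commutators into elements of higher degree,
    because [f [~ g, h] - 1] is a unit times an additive commutator of
    [f g - 1] and [f h - 1]. Both the powers of the augmentation ideal and the
    valuation filtration of the power series are instances. *)
Lemma lower_central_filtration (J : nat -> set A) :
  (forall k, is_ideal (J k)) -> (forall g, J 1%N (f g - 1)) ->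
  (forall i j x y, J i x -> J j y -> J (i + j)%N (x * y)) ->
  forall k g, (0 < k)%N -> gam k g -> J k (f g - 1).
Proof.
move=> iJ J1 JM; elim=> // -[_|k IH] g _; first by [].
rewrite lower_centralS //.
apply: (gen_subgroup_min (subgroup_congruence (iJ k.+2))).
move=> _ [a [b [ka _ ->]]]; rewrite /mkset morph_commg.
apply: (idealMl (iJ _)); apply: (idealB (iJ _)).
  by rewrite -addn1; apply: JM => //; apply: IH.
by rewrite -add1n; apply: JM => //; apply: IH.
Qed.

(** The generators are the powers [h ^+ e n i] with [h] in [gam i], and for
    these [f h - 1] lies in the [i]-th power of [I], so that [binomial_filt]
    applies. *)
Lemma power_lower_central_filt (I : set A) e n i g :
  binomial_map e -> (forall g, I (f g - 1)) -> (1 <= i <= n)%N ->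
  power_subgroup (gam i) (e n i) g -> ideal_filt I e n (f g - 1).
Proof.
move=> eb fI ni.
apply: (gen_subgroup_min (subgroup_congruence (ideal_filt_ideal I e n))).
move=> _ [h ih <-]; rewrite /mkset.
have -> : f (h ^+ e n i)%g = (f h - 1 + 1) ^+ e n i.
  rewrite subrK; elim: (e n i) => [|m IH]; first by rewrite expr0.
  by rewrite expgS fM IH exprS.
apply: binomial_filt => //.
apply: (lower_central_filtration (ideal_ideal_exp I)) => //.
- by move=> k; apply: ideal_exp1.
- by move=> p q x y; apply: ideal_expD.
- by case/andP: ni.
Qed.

Lemma lower_central_prod_filt (I : set A) e n :
  binomial_map e -> (forall g, I (f g - 1)) ->
  lower_central_prod G e n `<=` [set g | ideal_filt I e n (f g - 1)].
Proof.
move=> eb fI _ [g gP <-]; rewrite big_seq_cond.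
have sC := subgroup_congruence (ideal_filt_ideal I e n).
apply: (big_ind _ (subgroup1 sC) (subgroupM sC)) => i.
rewrite mem_index_iota andbT ltnS => ni.
exact: power_lower_central_filt eb fI ni (gP i ni).
Qed.

End GroupsInRings.

Section GroupAlgebraLift.
Variables (R A : pzRingType) (G : groupType) (c : R -> A) (f : G -> A).
Hypotheses (c0 : c 0 = 0) (c1 : c 1 = 1) (cD : {morph c : r s / r + s})
  (cM : {morph c : r s / r * s}) (cC : forall r x, c r * x = x * c r).
Hypotheses (fM : {morph f : g h / (g * h)%g >-> g * h}).
Local Notation RG := (group_algebra R G).
Implicit Types a b : RG.

(** The linear extension of [f] to the group algebra, the scalars acting on
    [A] through the central morphism [c]. *)
Definition galg_lift a : A := \sum_(g <- msupp a) c a@_g * f g.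

Lemma galg_liftw (s : {fset G}) a : (msupp a `<=` s)%fset ->
  galg_lift a = \sum_(g <- s) c a@_g * f g.
Proof.
move=> as_; rewrite /galg_lift (big_fset_incl _ as_) //= => g _.
by move=> /mcoeff_outdom ->; rewrite c0 mul0r.
Qed.

Lemma galg_lift0 : galg_lift 0 = 0.
Proof. by rewrite /galg_lift msupp0 big_seq_fset0. Qed.

Lemma galg_liftD : {morph galg_lift : a b / a + b}.
Proof.
move=> a b; pose s := (msupp a `|` msupp b)%fset.
rewrite (@galg_liftw s (a + b)) ?msuppD_le //.
rewrite (@galg_liftw s a) ?fsubsetUl // (@galg_liftw s b) ?fsubsetUr //.
by rewrite -big_split; apply: eq_bigr => g _; rewrite mcoeffD cD mulrDl.
Qed.

Lemma galg_liftU r g : galg_lift << r *g g >> = c r * f g.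
Proof. by rewrite (galg_liftw msuppU_le) big_seq_fset1 mcoeffUU. Qed.

Lemma galg_lift_of g : galg_lift (galg_of R g) = f g.
Proof. by rewrite galg_liftU c1 mul1r. Qed.

Lemma galg_liftM : {morph galg_lift : a b / a * b}.
Proof.
have lift_sum (I : Type) (s : seq I) (F : I -> RG) :
    galg_lift (\sum_(i <- s) F i) = \sum_(i <- s) galg_lift (F i).
  exact: (big_morph _ galg_liftD galg_lift0).
move=> a b; rewrite {1}[a]galgE {1}[b]galgE mulr_suml lift_sum {3}/galg_lift.
rewrite mulr_suml; apply: eq_bigr => g _.
rewrite -[X in galg_lift X]/(galg_mul _ _) galg_mul_sumr lift_sum mulr_sumr.
apply: eq_bigr => h _.
rewrite galg_mulUU galg_liftU cM fM.
by rewrite -!mulrA; congr (_ * _); rewrite !mulrA cC.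
Qed.
End GroupAlgebraLift.

Section ConstantSeries.
Variables (R : comPzRingType) (X : choiceType).
Local Notation S := (ncseries R X).

Lemma ncs_const_finite (r : R) n :
  finite_set [set w : seq X | size w = n /\ r * (w == [::])%:R != 0].
Proof.
apply: (sub_finite_set _ (finite_set1 [::])) => w [_] /=.
by case: (w =P [::]) => //; rewrite mulr0 eqxx.
Qed.

Definition ncs_const r : S := NCSeries (ncs_const_finite r).

Lemma ncs_const_mull r (s : S) w : (ncs_const r * s) w = r * s w.
Proof.
rewrite -[LHS]/(conv _ s w) -[s in RHS]mul1r.
exact: (conv_Zl r (1 : S) s w).
Qed.

Lemma ncs_const_mulr r (s : S) w : (s * ncs_const r) w = r * s w.
Proof.
rewrite -[s in RHS]mulr1 -[RHS]/(r * conv s (1 : S) w) -[LHS]/(conv _ _ w).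
by rewrite /conv mulr_sumr; apply: eq_bigr => i _ /=; rewrite mulrCA.
Qed.
End ConstantSeries.

Section MagnusFiltration.
Variables (R : comPzRingType) (X : choiceType).
Local Notation S := (ncseries R X).

Lemma magnus_var_ideal g : @var_ideal R X (magnus R g - 1).
Proof.
have iV : is_ideal (@var_ideal R X) := ideal_gen _.
have varV x : @var_ideal R X (ncs_var R x) by apply: sub_gen_ideal; exists x.
apply: (big_ind (fun s => @var_ideal R X (s - 1))) => [||[x b] _].
- by rewrite subrr; case: iV.
- move=> s t Vs Vt; have -> : s * t - 1 = (s - 1) * t + (t - 1).
    by rewrite mulrBl mul1r addrA subrK.
  by apply: (idealD iV) => //; apply: (idealMr iV).
case: b; rewrite /mu_letter /=; first by rewrite addrC addKr.
have -> : inv1var R x - 1 = - (inv1var R x * ncs_var R x).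
  by rewrite -[X in _ - X](inv1varK R x) mulrDr mulr1 opprD addNKr.
by apply: (idealN iV); apply: (idealMl iV).
Qed.

(** The linear extension of the Magnus map sends the augmentation ideal into
    the ideal of the variables, hence each filtration into the other. *)
Lemma group_algebra_filt_magnus e n :
  group_algebra_filt R X e n `<=` magnus_filt R X e n.
Proof.
pose lift := galg_lift (@ncs_const R X) (@magnus R X).
have c0 : ncs_const X (0 : R) = 0 by apply: ncseriesP => w; rewrite /= mul0r.
have c1 : ncs_const X (1 : R) = 1 by apply: ncseriesP => w; rewrite /= mul1r.
have cD : {morph @ncs_const R X : r s / r + s}.
  by move=> r s; apply: ncseriesP => w; rewrite /= mulrDl.
have cM : {morph @ncs_const R X : r s / r * s}.
  by move=> r s; apply: ncseriesP => w; rewrite ncs_const_mull /= mulrA.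
have cC r (s : S) : ncs_const X r * s = s * ncs_const X r.
  by apply: ncseriesP => w; rewrite ncs_const_mull ncs_const_mulr.
have lift0 : lift 0 = 0 := galg_lift0 _ _.
have liftD : {morph lift : a b / a + b} := galg_liftD _ c0 cD.
have liftM : {morph lift : a b / a * b}.
  exact: galg_liftM c0 cD cM cC (@magnusM R X).
have lift_of g : lift (galg_of R g) = magnus R g := galg_lift_of _ c0 c1 g.
have lift1 : lift 1 = 1 by rewrite -[RHS](magnus1 R X) -lift_of.
have liftB a : lift (a - 1) = lift a - 1.
  by apply/eqP; rewrite eq_sym subr_eq -lift1 -liftD subrK.
move=> g [a aI E]; exists (lift a).
  apply: (ideal_filt_morph lift0 liftD liftM) aI.
  apply: gen_ideal_min; first by apply: ideal_preimage => //; exact: ideal_gen.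
  move=> _ [h _ <-]; rewrite /preimage /mkset liftB lift_of.
  exact: magnus_var_ideal.
by rewrite -lift_of -E liftD lift1.
Qed.

End MagnusFiltration.

Lemma lower_central_prod_group_algebra (R : pzRingType) (X : choiceType) e n :
  binomial_map e ->
  lower_central_prod (free_group X) e n `<=` group_algebra_filt R X e n.
Proof.
move=> eb g gP; exists (galg_of R g - 1); last by rewrite addrC subrK.
apply: (lower_central_prod_filt (f := @galg_of R (free_group X))) gP => //.
- exact: galg_ofM.
- by move=> h; apply: sub_gen_ideal; exists h.
Qed.

(** * Lyndon words *)

Section LyndonWords.
Variables (d : Order.disp_t) (Y : orderType d).
Implicit Types (s t u v w : seq Y).
Local Open Scope order_scope.

Lemma lexi_cat2l w u v : (w ++ u <= w ++ v) = (u <= v).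
Proof. by elim: w => //= x w IH; rewrite lexi_cons lexx /= IH. Qed.

Lemma ltxi_cat2l w u v : (w ++ u < w ++ v) = (u < v).
Proof. by rewrite !ltNge lexi_cat2l. Qed.

Lemma lexi_catr u v : u <= u ++ v.
Proof. by rewrite -[u in u <= _]cats0 lexi_cat2l lexi0s. Qed.

Lemma ltxi_catr u v : v != [::] -> u < u ++ v.
Proof.
by rewrite -[u in u < _]cats0 ltxi_cat2l lt_neqAle lexi0s eq_sym andbT.
Qed.

(** Two words of which the first is not a prefix of the second are compared at
    the first position where they differ, so nothing that follows matters. *)
Lemma ltxi_cat u v s t : u < v -> ~~ prefix u v -> u ++ s < v ++ t.
Proof.
elim: u v => [|x u IH] [|y v] //=.
rewrite !ltxi_cons; case: (ltgtP x y) => //= _ lt_uv.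
exact: IH.
Qed.

(** If [v] is not longer than [u], then [u < v] cannot come from [u] being a
    prefix of [v]. *)
Lemma ltxi_cat_size u v s t : u < v -> (size v <= size u)%N ->
  u ++ s < v ++ t.
Proof.
move=> lt_uv svu; apply: ltxi_cat => //; apply/negP => puv.
move: lt_uv; have /eqP-> : u == v; last by rewrite ltxx.
by move/prefixP: puv svu => [r ->]; rewrite size_cat; case: r => [|z r];
  rewrite ?cats0 ?eqxx //= addnS ltnNge leq_addr.
Qed.

Lemma lexi_cat_size u v s t : u <= v -> s <= t -> (size v <= size u)%N ->
  u ++ s <= v ++ t.
Proof.
rewrite le_eqVlt => /orP[/eqP->|uv] st szs; first by rewrite lexi_cat2l.
exact/ltW/ltxi_cat_size.
Qed.

Definition lyndon w : bool :=
  (w != [::]) && [forall k : 'I_(size w), (0 < k)%N ==> (w < drop k w)].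

Lemma lyndonP w :
  reflect (w != [::] /\ forall k, (0 < k < size w)%N -> w < drop k w)
          (lyndon w).
Proof.
apply: (iffP andP) => [[w0 /forallP wP]|[w0 wP]]; split => //.
  by move=> k /andP[k0 kw]; have /implyP := wP (Ordinal kw); apply.
by apply/forallP => k; apply/implyP => k0; apply: wP; rewrite k0 /=.
Qed.

Lemma lyndon_letter x : lyndon [:: x].
Proof. by apply/lyndonP; split=> // [] [|[]]. Qed.

Lemma lyndon_neq0 w : lyndon w -> w != [::].
Proof. by case/andP. Qed.

(** The only delicate suffix is [v] itself: if [v = u ++ r], then [v < r]
    since [v] is Lyndon, whence [u ++ v < u ++ r]. *)
Lemma lyndon_cat u v : lyndon u -> lyndon v -> u < v -> lyndon (u ++ v).
Proof.
move=> /lyndonP[u0 uP] /lyndonP[v0 vP] uv.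
have uvv : u ++ v < v.
  have [/prefixP[r vE]|npuv] := boolP (prefix u v); last first.
    by rewrite -[X in _ < X]cats0; apply: ltxi_cat.
  have r0 : r != [::] by apply: contraTneq uv => r0; rewrite vE r0 cats0 ltxx.
  rewrite {2}vE ltxi_cat2l -[r](drop_size_cat _ (erefl (size u))) -vE vP //.
  rewrite vE size_cat !lt0n -{2}[size u]addn0 ltn_add2l lt0n.
  by rewrite !size_eq0 u0.
apply/lyndonP; split=> [|k]; first by case: (u) u0.
rewrite drop_cat size_cat => /andP[k0 kuv]; case: ltnP => [ku|uk].
  by apply: ltxi_cat_size; rewrite ?uP ?k0 // size_drop leq_subr.
have [->|] := posnP (k - size u); first by rewrite drop0.
move=> ku0; apply: lt_trans uvv _; apply: vP.
by rewrite ku0 ltn_subLR.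
Qed.

(** The standard factorization of [w] cuts it in front of its least proper
    nonempty suffix. The index in the minimum is the position of the cut less
    one, and it runs up to [(size w).-2], which leaves out the empty
    suffix. *)
Definition lcut w : nat :=
  (Order.arg_min (ord0 : 'I_(size w).-2.+1) xpredT (fun k => drop k.+1 w)).+1.

Definition lpre w : seq Y := take (lcut w) w.
Definition lsuf w : seq Y := drop (lcut w) w.

Lemma lpre_lsuf w : lpre w ++ lsuf w = w. Proof. exact: cat_take_drop. Qed.

Lemma lcut_bound w : (1 < size w)%N -> (0 < lcut w < size w)%N.
Proof.
rewrite /lcut; case: (Order.arg_min _ _ _) => k /=.
by case: (size w) => [|[|m]].
Qed.

Lemma lsuf_min w k : (0 < k < size w)%N -> lsuf w <= drop k w.
Proof.
rewrite /lsuf /lcut => /andP[k0 kw].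
case: arg_minP => //= i _ iP.
have kb : (k.-1 < (size w).-2.+1)%N.
  by case: (size w) k k0 kw => [|[|m]] [|[|k]].
by have := iP (Ordinal kb) isT; rewrite /= (prednK k0).
Qed.

Lemma size_lpre w : (1 < size w)%N -> (0 < size (lpre w) < size w)%N.
Proof.
by move/lcut_bound => /andP[c0 cw]; rewrite /lpre size_take cw c0 cw.
Qed.

Lemma size_lsuf w : (1 < size w)%N -> (0 < size (lsuf w) < size w)%N.
Proof.
move/lcut_bound => /andP[c0 cw]; rewrite size_drop subn_gt0 cw /=.
by rewrite ltn_subrL c0 (leq_ltn_trans _ cw).
Qed.

Lemma lyndon_lsuf w : (1 < size w)%N -> lyndon (lsuf w).
Proof.
move=> sw; have /andP[c0 cw] := lcut_bound sw; apply/lyndonP; split.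
  by rewrite -size_eq0 -lt0n; case/andP: (size_lsuf sw).
move=> k /andP[k0]; rewrite size_drop ltn_subRL => kw.
rewrite lt_neqAle /lsuf drop_drop addnC; apply/andP; split; last first.
  by apply: lsuf_min; rewrite kw (ltn_addr _ c0).
apply/negP => /eqP /(congr1 size); rewrite !size_drop.
by move: c0 cw k0 kw; set c := lcut w; set n := size w; clear; lia.
Qed.

(** Let [s] be a proper suffix of [lpre w] with [s < lpre w]. If [s] is no
    prefix of [lpre w], then [s ++ lsuf w] is smaller than [w]. If
    [lpre w = s ++ r], then [lsuf w <= r ++ lsuf w] by minimality, hence
    [s ++ lsuf w <= w]. Both contradict that [w] is Lyndon. *)
Lemma lyndon_lpre w : (1 < size w)%N -> lyndon w -> lyndon (lpre w).
Proof.
move=> sw /lyndonP[w0 wP]; have /andP[c0 cw] := lcut_bound sw.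
have spre : size (lpre w) = lcut w by rewrite size_takel // ltnW.
apply/lyndonP; split; first by rewrite -size_eq0 spre -lt0n.
move=> k /andP[k0]; rewrite spre => kc.
have kw : (0 < k < size w)%N by rewrite k0 (ltn_trans kc).
have dE : drop k w = drop k (lpre w) ++ lsuf w.
  by rewrite -{1}[w]lpre_lsuf drop_cat spre kc.
have := wP k kw; rewrite dE -{1}[w]lpre_lsuf ltNge => wlt.
rewrite ltNge le_eqVlt; apply/norP; split.
  by apply/negP => /eqP/(congr1 size); rewrite size_drop spre; lia.
apply: contra wlt => lt_s.
have [/prefixP[r rE]|np] := boolP (prefix (drop k (lpre w)) (lpre w));
  last exact/ltW/ltxi_cat.
have sr : size (drop k (lpre w)) = (lcut w - k)%N by rewrite size_drop spre.
have wE : w = drop k (lpre w) ++ (r ++ lsuf w) by rewrite catA -rE lpre_lsuf.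
rewrite [in leRHS]rE -catA lexi_cat2l -[leRHS](drop_size_cat _ sr) -wE.
by apply: lsuf_min; lia.
Qed.

Lemma lpre_lt_lsuf w : (1 < size w)%N -> lyndon w -> lpre w < lsuf w.
Proof.
move=> sw /lyndonP[_ wP]; apply: lt_trans (wP _ (lcut_bound sw)).
rewrite -{2}[w]lpre_lsuf; apply: ltxi_catr.
by rewrite -size_eq0 -lt0n; case/andP: (size_lsuf sw).
Qed.

(** A suffix of [u ++ v] that starts strictly inside [u] starts with a proper
    suffix of [u], which is at least [lsuf u]; so [v] is the least proper
    suffix unless it exceeds [lsuf u]. *)
Lemma lcut_cat u v : (0 < size u)%N -> lyndon v ->
  ((1 < size u)%N -> v <= lsuf u) -> lcut (u ++ v) = size u.
Proof.
move=> u0 vL vu; have /lyndonP[v0 vP] := vL.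
have sv : (0 < size v)%N by rewrite lt0n size_eq0.
have suv : (1 < size (u ++ v))%N by rewrite size_cat; lia.
have cu : (0 < size u < size (u ++ v))%N by rewrite size_cat; lia.
have := lsuf_min cu; rewrite drop_size_cat // => le_suf.
have /andP[c0 cw] := lcut_bound suv.
have : v <= lsuf (u ++ v).
  rewrite /lsuf drop_cat; case: ltnP => [cu'|uc].
    apply: le_trans (lexi_catr _ _); apply: le_trans (vu _) _; first by lia.
    by apply: lsuf_min; rewrite c0.
  have [->|p0] := posnP (lcut (u ++ v) - size u); first by rewrite drop0.
  by apply/ltW/vP; move: cw; rewrite p0 size_cat; lia.
move=> le_v; have /eqP : lsuf (u ++ v) = v by apply/le_anti; rewrite le_suf.
move=> /eqP/(congr1 size); rewrite size_drop size_cat.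
by move: cw; rewrite size_cat; move: (lcut _) (size u) (size v) => c a b; lia.
Qed.

End LyndonWords.

(** * Lyndon commutators span the lower central quotients *)

Section LyndonCommutators.
Variables (d : Order.disp_t) (Y : finOrderType d).
Local Notation F := (free_group Y).
Local Notation gam := (@lower_central F).
Local Arguments lower_central : simpl never.
Implicit Types (u v w x y : seq Y) (g h : F) (K : set F).
Local Open Scope group_scope.

(** Recursion on a bound [m] for the length of the word. *)
Fixpoint lyndon_comm_rec (m : nat) w : F :=
  if m is m'.+1 then
    if (1 < size w)%N then
      [~ lyndon_comm_rec m' (lpre w), lyndon_comm_rec m' (lsuf w)]
    else if w is x :: _ then fg_gen x else 1
  else 1.

(** The group commutator obtained by bracketing [w] along iterated standard
    factorizations. *)
Definition lyndon_comm w : F := lyndon_comm_rec (size w) w.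

Lemma lyndon_comm_rec_fuel m m' w : (size w <= m)%N -> (size w <= m')%N ->
  lyndon_comm_rec m w = lyndon_comm_rec m' w.
Proof.
elim: m m' w => [|m IH] [|m'] [|x w] // wm wm' /=; case: ifP => // w1.
have /andP[_ lp] := @size_lpre _ _ (x :: w) w1.
have /andP[_ ls] := @size_lsuf _ _ (x :: w) w1.
by congr [~ _, _]; apply: IH; rewrite -ltnS;
  apply: leq_trans wm || apply: leq_trans wm'.
Qed.

Lemma lyndon_comm_letter (x : Y) : lyndon_comm [:: x] = fg_gen x.
Proof. by []. Qed.

Lemma lyndon_commE w : (1 < size w)%N ->
  lyndon_comm w = [~ lyndon_comm (lpre w), lyndon_comm (lsuf w)].
Proof.
move=> w1; have /andP[_ lp] := size_lpre w1; have /andP[_ ls] := size_lsuf w1.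
rewrite {1}/lyndon_comm; move: lp ls.
case E: (size w) (w1) => [|m] // m1 lp ls /=.
by rewrite E m1; congr [~ _, _]; apply: lyndon_comm_rec_fuel.
Qed.

Lemma lyndon_comm_lower_central w : gam (size w) (lyndon_comm w).
Proof.
have [m] := ubnP (size w); elim: m w => // m IH w wm.
have [w1|] := leqP 2 (size w); last by case: w {wm} => [|x []].
have /andP[_ lp] := size_lpre w1; have /andP[_ ls] := size_lsuf w1.
rewrite lyndon_commE // -{1}[w]lpre_lsuf size_cat; rewrite ltnS in wm.
by apply: commg_lower_central; apply: IH; apply: leq_trans wm.
Qed.

(** As it contains [gam k.+1], this stands for a subgroup of the lower central
    quotient of degree [k]. *)
Definition lyndon_span k u : set F :=
  gen_subgroup (gam k.+1 `|` [set lyndon_comm w | w in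
    [set w | [/\ lyndon w, size w = k & (u <= w)%O]]]).

Lemma subgroup_lyndon_span k u : is_subgroup (lyndon_span k u).
Proof. exact: subgroup_gen. Qed.

Lemma lyndon_span_gam k u : gam k.+1 `<=` lyndon_span k u.
Proof. by move=> g kg; apply: sub_gen_subgroup; left. Qed.

Lemma lyndon_span_comm k u w : lyndon w -> size w = k -> (u <= w)%O ->
  lyndon_span k u (lyndon_comm w).
Proof. by move=> wL wk uw; apply: sub_gen_subgroup; right; exists w. Qed.

Lemma lyndon_span_min k u K : is_subgroup K -> gam k.+1 `<=` K ->
  (forall w, lyndon w -> size w = k -> (u <= w)%O -> K (lyndon_comm w)) ->
  lyndon_span k u `<=` K.
Proof.
move=> sK NK KL; apply: gen_subgroup_min => // g [/NK//|[w [wL wk uw] <-]].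
exact: KL.
Qed.

Lemma lyndon_span_le k u v : (v <= u)%O -> lyndon_span k u `<=` lyndon_span k v.
Proof.
move=> vu; apply: lyndon_span_min => [||w wL wk uw].
- exact: subgroup_lyndon_span.
- exact: lyndon_span_gam.
- by apply: lyndon_span_comm => //; apply: le_trans uw.
Qed.

(** By bilinearity, a commutator with an element of a span need only be
    controlled on the Lyndon commutators that generate the span. *)
Lemma lyndon_span_commg_l i j k u v h : (0 < i)%N -> (0 < j)%N ->
  (i + j = k)%N -> gam j h ->
  (forall w, lyndon w -> size w = i -> (u <= w)%O ->
     lyndon_span k v [~ lyndon_comm w, h]) ->
  forall g, lyndon_span i u g -> lyndon_span k v [~ g, h].
Proof.
move=> i0 j0 <- jh H g ug.
suff [] : [set g | gam i g /\ lyndon_span (i + j) v [~ g, h]] g by [].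
have sK := subgroup_lyndon_span (i + j) v.
move: g ug; apply: lyndon_span_min.
- exact: subgroup_commg_l i0 sK (@lyndon_span_gam _ _) jh.
- move=> g ig; split; first exact: lower_central_subS.
  by apply: lyndon_span_gam; rewrite -addSn; apply: commg_lower_central.
- move=> w wL wi uw; split; last exact: H.
  by rewrite -wi; exact: lyndon_comm_lower_central.
Qed.

Lemma lyndon_span_commg_r i j k u v g : (0 < i)%N -> (0 < j)%N ->
  (i + j = k)%N -> gam i g ->
  (forall w, lyndon w -> size w = j -> (u <= w)%O ->
     lyndon_span k v [~ g, lyndon_comm w]) ->
  forall h, lyndon_span j u h -> lyndon_span k v [~ g, h].
Proof.
move=> i0 j0 ijk ig H h uh; rewrite -invgR.
apply: (subgroupV (subgroup_lyndon_span _ _)).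
apply: (@lyndon_span_commg_l j i k u) => // [|w wL wj uw].
  by rewrite addnC.
by rewrite -invgR; apply: (subgroupV (subgroup_lyndon_span _ _)); apply: H.
Qed.

(** The span of the Lyndon commutators is closed under brackets. If [(u, v)]
    is the standard factorization of [u ++ v], the commutator is a Lyndon
    commutator. Otherwise [u = x ++ y] with [y < v], and the Jacobi identity
    leaves two terms. By induction on the length, the commutators of [x] with
    [v] and of [y] with [v] are combinations of Lyndon commutators of words
    [n] not less than [x ++ v] and [y ++ v]. Bracketing [n] with [y] or with
    [x] then gives a product of two Lyndon words that is larger than [u ++ v],
    or is equal to it with the shorter left factor [x]. As there are finitely
    many words of length [k], this recursion ends. *)
Lemma lyndon_span_commg u v k : lyndon u -> lyndon v -> (u < v)%O ->
  size (u ++ v) = k ->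
  lyndon_span k (u ++ v) [~ lyndon_comm u, lyndon_comm v].
Proof.
elim/ltn_ind: k u v => k IHk u v uL vL uv uvk.
(* The measure counts the words above [u ++ v], then the letters of [u]. *)
pose above w := #|[pred t : k.-tuple Y | (w < t)%O]|.
have aboveS w w' : size w' = k -> (w < w')%O -> (above w' < above w)%N.
  move=> /eqP w'k ww'; apply: proper_card; apply/properP; split.
    by apply/fintype.subsetP => t; rewrite !inE; apply: lt_trans.
  by exists (Tuple w'k); rewrite inE ?ltxx.
have [m] := ubnP (above (u ++ v) * k.+1 + size u)%N.
elim: m => // m IHm in u v uL vL uv uvk *; rewrite ltnS => measure_m.
have u0 : (0 < size u)%N by rewrite lt0n size_eq0 lyndon_neq0.
have v0 : (0 < size v)%N by rewrite lt0n size_eq0 lyndon_neq0.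
have step s t : lyndon s -> lyndon t -> (s < t)%O -> size (s ++ t) = k ->
    (u ++ v < s ++ t)%O \/ (u ++ v = s ++ t) /\ (size s < size u)%N ->
    lyndon_span k (u ++ v) [~ lyndon_comm s, lyndon_comm t].
  move=> sL tL st stk dec.
  apply: (@lyndon_span_le k (s ++ t)); first by case: dec => [/ltW|[->]].
  apply: IHm => //; apply: leq_trans measure_m.
  case: dec => [/(aboveS _ _ stk) lt_above|[-> szs]]; last by rewrite ltn_add2l.
  apply: (@leq_trans ((above (s ++ t)%SEQ).+1 * k.+1)).
    by rewrite mulSn addnC ltn_add2r ltnS -stk size_cat leq_addr.
  by apply: leq_trans (leq_addr _ _); rewrite leq_mul2r lt_above orbT.
have [vu|] := boolP ((1 < size u)%N ==> (v <= lsuf u)%O).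
  have cutE : lcut (u ++ v) = size u.
    by apply: lcut_cat => // u1; rewrite u1 in vu.
  have <- : lyndon_comm (u ++ v) = [~ lyndon_comm u, lyndon_comm v].
    rewrite lyndon_commE; last by rewrite size_cat; lia.
    by rewrite /lpre /lsuf cutE take_size_cat ?drop_size_cat.
  by apply: lyndon_span_comm => //; apply: lyndon_cat.
rewrite negb_imply -ltNge => /andP[u1 yv].
have xL := lyndon_lpre u1 uL; have yL := lyndon_lsuf u1.
have xy := lpre_lt_lsuf u1 uL; have uE := lpre_lsuf u.
have [x0 xu] : (0 < size (lpre u))%N /\ (size (lpre u) < size u)%N.
  exact/andP/size_lpre.
have [y0 yu] : (0 < size (lsuf u))%N /\ (size (lsuf u) < size u)%N.
  exact/andP/size_lsuf.
rewrite lyndon_commE //; set x := lpre u in xL xy uE x0 xu *.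
set y := lsuf u in yv yL xy uE y0 yu *.
have uy : (u < y)%O by case/lyndonP: uL => _; apply; apply: lcut_bound.
have szE : (size x + size y = size u)%N by rewrite -uE size_cat.
have szk : (size x + size y + size v = k)%N by rewrite szE -size_cat.
have xvk : (size x + size v < k)%N.
  by rewrite -szk addnAC -[X in (X < _)%N]addn0 ltn_add2l.
have yvk : (size y + size v < k)%N.
  by rewrite -szk -addnA -[X in (X < _)%N]add0n ltn_add2r.
have gx := lyndon_comm_lower_central x; have gy := lyndon_comm_lower_central y.
have gv := lyndon_comm_lower_central v.
have xv : (x < v)%O by apply: lt_trans yv.
have sK := subgroup_lyndon_span k (u ++ v).
apply: (commg_jacobi x0 y0 v0 sK _ gx gy gv).
- by rewrite szk; apply: lyndon_span_gam.
- apply: (@lyndon_span_commg_l (size x + size v) (size y) k (x ++ v)) => //.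
  + by rewrite addn_gt0 x0.
  + by rewrite -szk addnAC.
  + move=> n nL nk xvn.
    have nyk : (size n + size y = k)%N by rewrite nk -szk addnAC.
    have [ny|yn|->] := ltgtP n y; last by rewrite commgg; apply: subgroup1.
    * apply: step; rewrite ?size_cat //; left.
      apply: (@lt_le_trans _ _ (x ++ v ++ y)).
        rewrite -uE -catA ltxi_cat2l.
        apply: lt_le_trans (lexi_catr _ _).
        have /lyndonP[_ /(_ (size y))] := lyndon_cat yL vL yv.
        rewrite drop_size_cat // size_cat; apply.
        by rewrite y0 -[X in (X < _)%N]addn0 ltn_add2l.
      by rewrite catA; apply: lexi_cat_size; rewrite ?size_cat ?nk.
    * rewrite -invgR; apply: (subgroupV sK); apply: step; rewrite ?size_cat //.
        by rewrite addnC.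
      by left; apply: ltxi_cat_size; rewrite // ltnW.
  + by apply: IHk => //; rewrite ?size_cat.
- apply: (@lyndon_span_commg_r (size x) (size y + size v) k (y ++ v)) => //.
  + by rewrite addn_gt0 y0.
  + by rewrite addnA.
  + move=> n nL nk yvn.
    have yn : (y < n)%O.
      by apply: lt_le_trans yvn; apply: ltxi_catr (lyndon_neq0 vL).
    apply: step => //; first exact: lt_trans yn.
      by rewrite size_cat nk addnA.
    have : (x ++ (y ++ v) <= x ++ n)%O by rewrite lexi_cat2l.
    rewrite catA uE le_eqVlt => /orP[/eqP->|?]; [by right|by left].
  + by apply: IHk => //; rewrite ?size_cat.
Qed.

(** The lower central quotients form a Lie ring generated by its part of
    degree one, so a span that contains the letters and is closed under
    brackets is everything. *)
Lemma lower_central_lyndon k : (0 < k)%N -> gam k `<=` lyndon_span k [::].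
Proof.
have sK j := subgroup_lyndon_span j [::].
have comm i j u v : lyndon u -> lyndon v -> size u = i -> size v = j ->
    lyndon_span (i + j) [::] [~ lyndon_comm u, lyndon_comm v].
  move=> uL vL <- <-.
  have [uv|vu|->] := ltgtP u v; last by rewrite commgg; apply: subgroup1.
    apply: (lyndon_span_le (lexi0s (u ++ v))).
    by apply: lyndon_span_commg => //; rewrite size_cat.
  rewrite -invgR; apply: (subgroupV (sK _)).
  apply: (lyndon_span_le (lexi0s (v ++ u))).
  by apply: lyndon_span_commg => //; rewrite size_cat addnC.
have span1 g : lyndon_span 1 [::] g.
  rewrite [g]fg_prodE; apply: big_ind => [||[x b] _].
  - exact: subgroup1.
  - exact: subgroupM.
  have xK : lyndon_span 1 [::] (fg_gen x).
    rewrite -lyndon_comm_letter; apply: lyndon_span_comm => //.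
    exact: lyndon_letter.
  by case: b => //=; apply: (subgroupV (sK _)).
elim: k => // -[_ _|k IH _]; first by move=> g _; apply: span1.
rewrite lower_centralS //; apply: gen_subgroup_min => // _ [g [h [kg _ ->]]].
apply: (@lyndon_span_commg_r k.+1 1 k.+2 [::] [::] g) => //.
  by rewrite addn1.
move=> w wL w1 _; apply: (@lyndon_span_commg_l k.+1 1 k.+2 [::]) => //.
- by rewrite addn1.
- by move=> v vL vk _; rewrite -addn1; apply: comm.
- exact: IH.
Qed.

End LyndonCommutators.

(** * Lowest forms of Magnus expansions *)

Section Valuation.
Variables (R : pzRingType) (X : choiceType).
Local Notation S := (ncseries R X).
Local Notation gam := (@lower_central (free_group X)).
Local Notation mu := (@magnus R X).
Implicit Types (s t : S) (w v : seq X) (g h : free_group X).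

Lemma ncs_mulE s t w :
  (s * t) w = \sum_(i < (size w).+1) s (take i w) * t (drop i w).
Proof. by []. Qed.

Lemma ncs_addE s t w : (s + t) w = s w + t w. Proof. by []. Qed.
Lemma ncs_oppE s w : (- s) w = - s w. Proof. by []. Qed.
Lemma ncs_1E w : (1 : S) w = (w == [::])%:R. Proof. by []. Qed.
Lemma ncs_0E w : (0 : S) w = 0. Proof. by []. Qed.

Lemma ncs_mulrnE s m w : (s *+ m) w = s w *+ m.
Proof. by elim: m => // m IH; rewrite !mulrS ncs_addE IH. Qed.

Definition val_ge (k : nat) : set S :=
  [set s | forall w, (size w < k)%N -> s w = 0].

Lemma val_geM i j s t : val_ge i s -> val_ge j t -> val_ge (i + j) (s * t).
Proof.
move=> si tj w wij; rewrite ncs_mulE big1 // => l _.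
have lw : (l <= size w)%N by rewrite -ltnS.
have [li|il] := ltnP l i; first by rewrite si ?mul0r // size_takel.
by rewrite tj ?mulr0 // size_drop; lia.
Qed.

(** In the lowest degree that can occur, a product of series is a product of
    forms. *)
Lemma val_ge_lead i j s t w : val_ge i s -> val_ge j t -> size w = (i + j)%N ->
  (s * t) w = s (take i w) * t (drop i w).
Proof.
move=> si tj wij; have iw : (i < (size w).+1)%N by rewrite wij ltnS leq_addr.
rewrite ncs_mulE (bigD1 (Ordinal iw)) //= big1 ?addr0 // => -[l lw] /=.
rewrite -val_eqE /= neq_ltn => /orP[li|il].
  by rewrite si ?mul0r // size_takel // -ltnS.
by rewrite tj ?mulr0 // size_drop wij; lia.
Qed.

Lemma ideal_val_ge k : is_ideal (val_ge k).
Proof.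
split=> [w _|s t sk tk w wk|s t tk|s t tk].
- exact: ncs_0E.
- by rewrite ncs_addE sk ?tk ?addr0.
- by rewrite -[k]add0n; apply: val_geM.
- by rewrite -[k]addn0; apply: val_geM.
Qed.

Lemma var_ideal_exp_val k : ideal_exp (@var_ideal R X) k `<=` val_ge k.
Proof.
apply: ideal_exp_min => [k'|//|i s t Vs ti]; first exact: ideal_val_ge.
rewrite -add1n; apply: val_geM => //.
apply: (gen_ideal_min (ideal_val_ge 1)) Vs => _ [x _ <-] [|] //.
Qed.

Lemma magnus_nil g : mu g [::] = 1.
Proof.
rewrite /magnus; apply: (big_ind (fun s : S => s [::] = 1)) => [||[x []] _].
- exact: ncs_1E.
- by move=> s t s1 t1; rewrite ncs_mulE big_ord1 /= s1 t1 mulr1.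
- by rewrite /mu_letter /= addr0.
- by rewrite /mu_letter /= /inv1var_coef.
Qed.

Lemma magnus_val1 g : val_ge 1 (mu g - 1).
Proof. by case=> // _; rewrite ncs_addE ncs_oppE ncs_1E magnus_nil subrr. Qed.

Lemma lower_central_val k g : (0 < k)%N -> gam k g -> val_ge k (mu g - 1).
Proof.
apply: (lower_central_filtration (magnus1 R X) (@magnusM R X)).
- exact: ideal_val_ge.
- exact: magnus_val1.
- exact: val_geM.
Qed.

Lemma magnus_sub1 g w : w != [::] -> (mu g - 1) w = mu g w.
Proof. by move=> /negPf w0; rewrite ncs_addE ncs_oppE ncs_1E w0 subr0. Qed.

Lemma lower_central_magnus_mul k g h w : (0 < k)%N -> gam k g -> gam k h ->
  size w = k -> mu (g * h)%g w = mu g w + mu h w.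
Proof.
move=> k0 kg kh wk; have w0 : w != [::] by rewrite -size_eq0 wk -lt0n.
rewrite -![mu _ w](magnus_sub1 _ w0) magnusM.
have -> : mu g * mu h - 1 = (mu g - 1) * mu h + (mu h - 1).
  by rewrite mulrBl mul1r addrA subrK.
rewrite [LHS]ncs_addE (@val_ge_lead k 0) ?addn0 //;
  last exact: lower_central_val.
by rewrite -wk take_size drop_size magnus_nil mulr1.
Qed.

Lemma lower_central_magnus_inv k g w : (0 < k)%N -> gam k g ->
  size w = k -> mu g^-1%g w = - mu g w.
Proof.
move=> k0 kg wk; apply/eqP; rewrite -addr_eq0; apply/eqP.
have kV := subgroupV (@subgroup_lower_central _ k) kg.
rewrite -(lower_central_magnus_mul k0 kV kg wk).
rewrite mulVg magnus1 ncs_1E.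
by case: w wk => [|//] /eqP; rewrite /= eq_sym (gtn_eqF k0).
Qed.

Lemma lower_central_magnus_exp k g w m : (0 < k)%N -> gam k g ->
  size w = k -> mu (g ^+ m)%g w = mu g w *+ m.
Proof.
move=> k0 kg wk; elim: m => [|m IH].
  rewrite mulr0n magnus1 ncs_1E.
  by case: w wk => [|//] /eqP; rewrite /= eq_sym (gtn_eqF k0).
have kX := subgroupX (@subgroup_lower_central _ k) m kg.
by rewrite expgS mulrS (lower_central_magnus_mul k0 kg kX wk) IH.
Qed.

Lemma lower_central_magnus0 k g w : (0 < size w < k)%N -> gam k g ->
  mu g w = 0.
Proof.
move=> /andP[w0 wk] kg; rewrite -magnus_sub1 -?size_eq0 -?lt0n //.
by apply: (lower_central_val _ kg) => //; apply: leq_ltn_trans wk.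
Qed.

(** The lowest form of a commutator is the Lie bracket of the lowest forms. *)
Lemma magnus_commg i j g h w : (0 < i)%N -> (0 < j)%N -> gam i g -> gam j h ->
  size w = (i + j)%N ->
  mu [~ g, h]%g w = mu g (take i w) * mu h (drop i w)
                    - mu h (take j w) * mu g (drop j w).
Proof.
move=> i0 j0 ig jh wij.
have w0 : w != [::] by rewrite -size_eq0 wij; lia.
have n0 (u : seq X) : (0 < size u)%N -> u != [::] by rewrite -size_eq0 lt0n.
rewrite -[LHS](magnus_sub1 _ w0) (morph_commg (magnus1 R X) (@magnusM R X)).
have gi := lower_central_val i0 ig; have hj := lower_central_val j0 jh.
rewrite (@val_ge_lead 0 (i + j)) //; last first.
  apply: (idealB (ideal_val_ge _)); first exact: val_geM.
  by rewrite addnC; apply: val_geM.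
rewrite take0 drop0 -magnusM magnus_nil mul1r ncs_addE ncs_oppE.
rewrite (val_ge_lead gi hj) // (val_ge_lead hj gi) 1?addnC //.
rewrite !magnus_sub1 ?n0 ?size_takel ?size_drop ?wij //; lia.
Qed.

End Valuation.

Section LyndonLeading.
Variables (d : Order.disp_t) (Y : finOrderType d) (R : pzRingType).
Local Notation F := (free_group Y).
Local Notation gam := (@lower_central F).
Local Notation mu := (@magnus R Y).
Implicit Types (u v w : seq Y) (g h : F).

(** The lowest form of the commutator of [w] is [w] plus larger words of its
    length: with [w = u ++ v] it is the bracket of the forms of [u] and [v],
    in which the first product only involves words that are at least [u ++ v],
    and the second one words that are at least [v ++ u], which exceeds [w]. *)
Lemma magnus_lyndon w : lyndon w ->
  mu (lyndon_comm w) w = 1 /\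
  forall v, size v = size w -> (v < w)%O -> mu (lyndon_comm w) v = 0.
Proof.
have [m] := ubnP (size w); elim: m w => // m IH w; rewrite ltnS => wm wL.
have [w1|] := leqP 2 (size w); last first.
  case: w wL {wm} => [|x [|]] // _ _; rewrite lyndon_comm_letter magnus_gen.
  split=> [|[|y []] //]; rewrite ncs_addE ncs_1E ?add0r /= ?eqxx //.
  by move=> _ yx; rewrite (lt_eqF yx).
have uL := lyndon_lpre w1 wL; have vL := lyndon_lsuf w1.
have wv : (w < lsuf w)%O by case/lyndonP: wL => _; apply; apply: lcut_bound.
have /andP[u0 uw] := size_lpre w1; have /andP[v0 vw] := size_lsuf w1.
have wE := lpre_lsuf w; rewrite lyndon_commE //.
have gu := lyndon_comm_lower_central (lpre w).
have gv := lyndon_comm_lower_central (lsuf w).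
have [u1 uP] := IH _ (leq_trans uw wm) uL.
have [v1 vP] := IH _ (leq_trans vw wm) vL.
move: (lpre w) (lsuf w) => u v in uL vL wv u0 uw v0 vw wE gu gv u1 uP v1 vP *.
have swE : (size w = size u + size v)%N by rewrite -wE size_cat.
(* The terms of [v * u] are at least [v ++ u], hence larger than [w]. *)
have vu0 t : size t = size w -> (t <= w)%O ->
    mu (lyndon_comm v) (take (size v) t) *
    mu (lyndon_comm u) (drop (size v) t) = 0.
  move=> st tw.
  have s1 : size (take (size v) t) = size v.
    by rewrite size_takel // st swE leq_addl.
  have s2 : size (drop (size v) t) = size u by rewrite size_drop st swE addnK.
  have [/(vP _ s1)->|vt] := ltP (take (size v) t) v; first by rewrite mul0r.
  have [/(uP _ s2)->|ut] := ltP (drop (size v) t) u; first by rewrite mulr0.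
  have : (v ++ u <= w)%O.
    apply: le_trans tw.
    by rewrite -[t](cat_take_drop (size v)) lexi_cat_size ?s1.
  by rewrite leNgt (lt_le_trans wv (lexi_catr _ _)).
split=> [|t st tw]; rewrite (magnus_commg R u0 v0 gu gv) ?st //.
  by rewrite vu0 // subr0 -wE take_size_cat ?drop_size_cat // u1 v1 mulr1.
rewrite vu0 ?(ltW tw) // subr0.
have s1 : size (take (size u) t) = size u.
  by rewrite size_takel // st swE leq_addr.
have s2 : size (drop (size u) t) = size v by rewrite size_drop st swE addKn.
have [/(uP _ s1)->|ut] := ltP (take (size u) t) u; first by rewrite mul0r.
have [/(vP _ s2)->|vt] := ltP (drop (size u) t) v; first by rewrite mulr0.
have : (w <= t)%O.
  by rewrite -wE -[t](cat_take_drop (size u)) lexi_cat_size ?s1.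
by rewrite leNgt tw.
Qed.
End LyndonLeading.

(** * Divisible forms come from powers *)

Section DivisibleForms.
Variables (d : Order.disp_t) (Y : finOrderType d).
Local Notation F := (free_group Y).
Local Notation gam := (@lower_central F).
Local Notation mu := (@magnus int Y).
Implicit Types (u v w : seq Y) (g h : F).

(** A variant of [lyndon_span] that allows an induction on the list of the
    words involved. *)
Definition lyndon_seq_span k (ws : seq (seq Y)) : set F :=
  gen_subgroup (gam k.+1 `|` [set lyndon_comm w | w in
    [set w | [/\ lyndon w, size w = k & w \in ws]]]).

Lemma subgroup_lyndon_seq_span k ws : is_subgroup (lyndon_seq_span k ws).
Proof. exact: subgroup_gen. Qed.

Lemma lyndon_seq_span_gam k ws : gam k.+1 `<=` lyndon_seq_span k ws.
Proof. by move=> g kg; apply: sub_gen_subgroup; left. Qed.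

Lemma lyndon_seq_span_sub k ws : lyndon_seq_span k ws `<=` gam k.
Proof.
apply: gen_subgroup_min; first exact: subgroup_lower_central.
move=> g [/lower_central_subS//|[w [_ wk _] <-]].
by rewrite -wk; apply: lyndon_comm_lower_central.
Qed.

(** [lyndon_seq_span k ws] is normal, so a cyclic group may be split off. The
    two exponents stand for the integer [a - b]. *)
Lemma lyndon_seq_span_cons k w ws : lyndon w -> size w = k ->
  lyndon_seq_span k (w :: ws) `<=`
  [set g | exists a b h, lyndon_seq_span k ws h /\
     g = (lyndon_comm w ^+ a / lyndon_comm w ^+ b * h)%g].
Proof.
move=> wL wk; set x := lyndon_comm w.
have sK := subgroup_lyndon_seq_span k ws.
have conjK h (y : F) : lyndon_seq_span k ws h -> lyndon_seq_span k ws (h ^ y)%g.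
  move=> Kh; rewrite conjg_mulR; apply: (subgroupM sK) => //.
  have kh := lyndon_seq_span_sub Kh.
  by apply: lyndon_seq_span_gam; apply: commg_lower_central1.
apply: gen_subgroup_min => [|g [kg|[v [vL vk]]]].
- split=> [|_ _ [a [b [g [Kg ->]]]] [p [q [h [Kh ->]]]]].
    exists 0%N, 0%N, 1%g; split; first exact: subgroup1.
    by rewrite !expg0 !gnorm.
  exists (a + q)%N, (b + p)%N, ((g * h^-1) ^ (x ^+ p / x ^+ q)^-1)%g.
  split; first by apply: conjK; apply: sK.2.
  have -> : (x ^+ (a + q) / x ^+ (b + p) =
             x ^+ a / x ^+ b * (x ^+ p / x ^+ q)^-1)%g.
    rewrite invgF !expgnDr invgM -!mulgA; congr (_ * _)%g; rewrite !mulgA.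
    rewrite [in RHS](_ : (x ^+ b)^-1 * x ^+ q = x ^+ q * (x ^+ b)^-1)%g.
      by rewrite -!mulgA -!invgM -!expgnDr addnC.
    by apply/commute_sym/commuteV/commuteX2.
  by rewrite invgM -[in RHS]mulgA -conjgC !mulgA.
- exists 0%N, 0%N, g; split; first exact: lyndon_seq_span_gam.
  by rewrite !expg0 !gnorm.
rewrite inE => /orP[/eqP-> <-|vws <-].
  exists 1%N, 0%N, 1%g; split; first exact: subgroup1.
  by rewrite expg0 expg1 !gnorm.
exists 0%N, 0%N, (lyndon_comm v); split; last by rewrite !expg0 !gnorm.
by apply: sub_gen_subgroup; right; exists v.
Qed.

(** Triangularity: the coefficients of [mu h] at the Lyndon words of length
    [k] determine, one after the other, the exponents of the Lyndon
    commutators in [h]; so these exponents are divisible by [m] if the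
    coefficients are. *)
Lemma lyndon_seq_span_power k ws (m : nat) h : (0 < k)%N ->
  sorted (fun u v => (u < v)%O) ws ->
  {in ws, forall w, lyndon w /\ size w = k} ->
  lyndon_seq_span k ws h -> (forall v, size v = k -> (m%:Z %| mu h v)%Z) ->
  exists p q, [/\ power_subgroup (gam k) m p, gam k.+1 q & h = (p * q)%g :> F].
Proof.
move=> k0; elim: ws h => [|w ws IH] h sw wsL Kh mh.
  exists 1%g, h; split; rewrite ?mul1g //.
    exact: subgroup1 (subgroup_gen _).
  move: Kh; apply: gen_subgroup_min; first exact: subgroup_lower_central.
  by move=> g [//|[w []]].
have [wL wk] : lyndon w /\ size w = k by apply: wsL; rewrite mem_head.
have [a [b [h' [Kh' hE]]]] := lyndon_seq_span_cons wL wk Kh.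
set x := lyndon_comm w in hE.
have kx : gam k x by rewrite -wk; apply: lyndon_comm_lower_central.
have kX c := subgroupX (@subgroup_lower_central F k) c kx.
have kh' := lyndon_seq_span_sub Kh'.
have kab : gam k (x ^+ a / x ^+ b)%g.
  exact: (@subgroup_lower_central F k).2 (kX a) (kX b).
have muE v : size v = k -> mu h v = mu x v * (a%:Z - b%:Z) + mu h' v.
  move=> vk; rewrite hE (lower_central_magnus_mul _ k0 kab kh' vk).
  rewrite (lower_central_magnus_mul _ k0 (kX a) _ vk); last first.
    exact: (subgroupV (@subgroup_lower_central F k)).
  rewrite (lower_central_magnus_inv _ k0 (kX b) vk).
  rewrite !(lower_central_magnus_exp _ _ k0 kx vk).
  by rewrite mulrBr -[a%:Z]natz -[b%:Z]natz !mulr_natr.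
have muh'w : mu h' w = 0.
  pose Z := [set g | gam k g /\ mu g w = 0].
  suff [] : Z h' by [].
  have sZ : is_subgroup Z.
    split; first by split; [exact: subgroup1 (@subgroup_lower_central F k)|
      rewrite magnus1 ncs_1E; case: (w) wL].
    move=> g1 g2 [kg1 z1] [kg2 z2]; split.
      exact: (@subgroup_lower_central F k).2.
    rewrite (lower_central_magnus_mul _ k0 kg1 _ wk) ?z1; last first.
      exact: (subgroupV (@subgroup_lower_central F k)).
    by rewrite (lower_central_magnus_inv _ k0 kg2 wk) z2 subrr.
  move: h' Kh' {hE kh' muE}.
  apply: gen_subgroup_min => // g [kg|[v [vL vk vws] <-]].
    split; first exact: lower_central_subS.
    by apply: lower_central_magnus0 kg; rewrite wk k0 ltnSn.
  split; first by rewrite -vk; apply: lyndon_comm_lower_central.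
  have wv : (w < v)%O.
    by move: sw => /= /(order_path_min lt_trans)/allP; apply.
  by have [_] := magnus_lyndon int vL; apply=> //; rewrite wk.
have mab : (m%:Z %| a%:Z - b%:Z)%Z.
  have := mh w wk; rewrite muE // muh'w addr0.
  by have [-> _] := magnus_lyndon int wL; rewrite mul1r.
have [||//|v vk|p [q [Pp kq h'E]]] := IH h'.
- exact: path_sorted sw.
- by move=> v vws; apply: wsL; rewrite inE vws orbT.
- have := mh v vk; rewrite muE // => mv.
  rewrite -[mu h' v](addKr (mu x v * (a%:Z - b%:Z))).
  by rewrite rpredD ?rpredN ?dvdz_mull.
exists (x ^+ a / x ^+ b * p)%g, q; split => //; last by rewrite hE h'E mulgA.
apply: (subgroupM (subgroup_gen _)) => //.
have pow c : (m %| c)%N -> power_subgroup (gam k) m (x ^+ c)%g.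
  move=> /dvdnP[r ->]; rewrite expgnA; apply: sub_gen_subgroup.
  by exists (x ^+ r)%g.
have [ba|/ltnW ab] := leqP b a.
  by rewrite -expgnFr //; apply: pow; move: mab; rewrite subzn.
rewrite -[(x ^+ a / x ^+ b)%g]invgK invgF -expgnFr //.
apply: (subgroupV (subgroup_gen _)); apply: pow.
by move: mab; rewrite -rpredN opprB subzn.
Qed.

(** In other words, the lower central quotient of degree [k] embeds into the
    forms of degree [k] with a torsion-free cokernel; the least words of the
    Lyndon commutators exhibit this. *)
Lemma lower_central_power k (m : nat) h : (0 < k)%N -> gam k h ->
  (forall v, size v = k -> (m%:Z %| mu h v)%Z) ->
  exists p q, [/\ power_subgroup (gam k) m p, gam k.+1 q & h = (p * q)%g :> F].
Proof.
move=> k0 kh mh.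
pose ws := sort (fun u v => (u <= v)%O)
  [seq tval s | s <- enum [pred s : k.-tuple Y | lyndon s]].
have wsP w : (w \in ws) = (lyndon w && (size w == k)).
  rewrite mem_sort; apply/mapP/andP => [[s]|[wL wk]].
    by rewrite mem_enum => sL ->; rewrite size_tuple.
  by exists (Tuple wk) => //; rewrite mem_enum.
apply: (@lyndon_seq_span_power k ws) => //.
- rewrite lt_sorted_uniq_le sort_le_sorted andbT sort_uniq.
  by rewrite map_inj_uniq ?enum_uniq //; exact: val_inj.
- by move=> w; rewrite wsP => /andP[wL /eqP].
move: (lower_central_lyndon k0 kh) => {kh mh}; move: h; apply: lyndon_span_min.
- exact: subgroup_lyndon_seq_span.
- exact: lyndon_seq_span_gam.
move=> w wL wk _; apply: sub_gen_subgroup; right; exists w => //.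
by split=> //; rewrite wsP wL wk /=.
Qed.

End DivisibleForms.

(** * The converse inclusion over the integers *)

Lemma mult_descending_dvd e n i j : mult_descending e ->
  (0 < i <= j)%N -> (j <= n)%N -> (e n j %| e n i)%N.
Proof.
move=> [_ ed] /andP[i0 /subnK <-]; elim: (j - i)%N => // k IH kn.
apply: dvdn_trans (IH _); first by apply: ed kn; rewrite addn_gt0 i0 orbT.
exact: ltnW.
Qed.

Section CoefficientDivisibility.
Variables (X : choiceType) (e : nat -> nat -> nat) (n : nat).
Hypothesis ed : mult_descending e.
Local Notation S := (ncseries int X).

(** A condition on single coefficients which all elements of the filtration
    satisfy, and which is all that the descent needs; being an ideal, it
    defines a congruence subgroup. *)
Definition coef_dvd : set S :=
  [set s | s [::] = 0 /\
           forall w, (0 < size w <= n)%N -> ((e n (size w))%:Z %| s w)%Z].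

Lemma ideal_coef_dvd : is_ideal coef_dvd.
Proof.
have sub (s : S) w v : coef_dvd s -> (0 < size w <= n)%N ->
    (size v <= size w)%N -> ((e n (size w))%:Z %| s v)%Z.
  move=> [s0 sP] /andP[w0 wn]; case: v => [|x v] vw; first by rewrite s0 dvdz0.
  apply: dvdz_trans (sP _ _); last by rewrite /= (leq_trans vw).
  by rewrite dvdzE /=; apply: mult_descending_dvd.
split=> [|s t [s0 sP] [t0 tP]|a s sP|a s sP]; split=> //.
- by rewrite ncs_addE s0 t0.
- by move=> w wn; rewrite ncs_addE rpredD ?sP ?tP.
- by rewrite ncs_mulE big_ord1 /= sP.1 mulr0.
- move=> w wn; rewrite ncs_mulE rpred_sum // => i _; rewrite dvdz_mull //.
  by apply: sub => //; rewrite size_drop leq_subr.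
- by rewrite ncs_mulE big_ord1 /= sP.1 mul0r.
- move=> w wn; rewrite ncs_mulE rpred_sum // => i _; rewrite dvdz_mulr //.
  by apply: sub => //; rewrite size_take_min geq_minr.
Qed.

Lemma ideal_filt_coef_dvd : ideal_filt (@var_ideal int X) e n `<=` coef_dvd.
Proof.
move=> _ [b bV <-]; rewrite big_seq; apply: (ideal_sum ideal_coef_dvd) => i.
rewrite mem_index_iota ltnS => ni; have bi := var_ideal_exp_val (bV i ni).
case/andP: ni => i0 ni.
split=> [|w /andP[w0 wn]]; rewrite ncs_mulrnE; first by rewrite bi ?mul0rn.
have [wi|iw] := ltnP (size w) i; first by rewrite bi // mul0rn dvdz0.
rewrite -mulr_natr dvdz_mull // natz dvdzE /=.
by apply: mult_descending_dvd; rewrite ?i0.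
Qed.

Lemma magnus_filt_coef_dvd :
  magnus_filt int X e n `<=` [set g | coef_dvd (magnus int g - 1)].
Proof.
move=> g [s /ideal_filt_coef_dvd sP sE].
by rewrite /mkset -[magnus int g]sE [1 + s]addrC addrK.
Qed.
End CoefficientDivisibility.

Section Descent.
Variables (d : Order.disp_t) (Y : finOrderType d).
Local Notation F := (free_group Y).
Local Notation gam := (@lower_central F).
Local Notation mu := (@magnus int Y).

(** The factors [p i] are split off from the left one degree at a time. The
    remainder [h] in [gam j.+1] still satisfies the divisibility condition, as
    [g] and the factors do, so its form of degree [j.+1] is divisible by
    [e n j.+1] and the next factor can be extracted. *)
Lemma coef_dvd_lower_central_prod e n (g : F) : binomial_map e -> (1 <= n)%N ->
  coef_dvd e n (mu g - 1) -> lower_central_prod F e n g.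
Proof.
move=> eb n1 gD; have [ed _] := eb; have [enn _] := ed.
have iC := ideal_coef_dvd Y n ed.
have sC := subgroup_congruence (magnus1 int Y) (@magnusM int Y) iC.
have descent j : (j < n)%N -> exists (p : nat -> F) (h : F),
    [/\ forall i, (1 <= i <= j)%N -> power_subgroup (gam i) (e n i) (p i),
        gam j.+1 h & g = (\prod_(1 <= i < j.+1) p i * h)%g].
  elim: j => [|j IH] jn.
    exists (fun=> 1%g), g; split=> // [i|]; first by case: i.
    by rewrite big_geq // mul1g.
  have [p [h [pP jh gE]]] := IH (ltnW jn).
  have Cp i : (1 <= i <= j)%N -> coef_dvd e n (mu (p i) - 1).
    move=> ij; apply: (ideal_filt_coef_dvd ed).
    apply: (power_lower_central_filt (magnus1 int Y) (@magnusM int Y) eb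
              (@magnus_var_ideal int Y) _ (pP i ij)).
    by case/andP: ij => -> /= ij; apply: leq_trans ij (ltnW (ltnW jn)).
  have Ch : coef_dvd e n (mu h - 1).
    have -> : h = ((\prod_(1 <= i < j.+1) p i)^-1 * g)%g by rewrite gE mulKg.
    apply: (subgroupM sC) => //; apply: (subgroupV sC).
    rewrite big_seq; apply: big_ind => [||i].
    - exact: (subgroup1 sC).
    - exact: (subgroupM sC).
    - by rewrite mem_index_iota ltnS; apply: Cp.
  have [v vj|q [r [qP rP hE]]] :=
    @lower_central_power _ Y j.+1 (e n j.+1) h isT jh.
    have v0 : v != [::] by rewrite -size_eq0 vj.
    by rewrite -(magnus_sub1 _ _ v0) -vj; apply: Ch.2; rewrite vj (ltnW jn).
  exists (fun i => if i == j.+1 then q else p i), r; split=> //.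
    move=> i /andP[i1 ij]; case: eqP => [->//|/eqP ij1].
    by apply: pP; rewrite i1 -ltnS ltn_neqAle ij1.
  rewrite gE hE mulgA [in RHS]big_nat_recr // eqxx; congr (_ * _ * _)%g.
  by apply: eq_big_nat => i /andP[_ ij]; rewrite ltn_eqF.
have [|p [h [pP jh gE]]] := descent n.-1; first by rewrite prednK.
rewrite prednK // in jh gE *.
(* As [e n n = 1], the last remainder is itself an admissible factor. *)
exists (fun i => if i == n then h else p i) => [i /andP[i1 ni]|].
  case: eqP => [->|/eqP nEi].
    by rewrite enn //; apply: sub_gen_subgroup; exists h; rewrite ?expg1.
  by apply: pP; rewrite i1 -ltnS prednK // ltn_neqAle nEi.
rewrite big_nat_recr // eqxx gE; congr (_ * _)%g.
by apply: eq_big_nat => i /andP[_ ij]; rewrite ltn_eqF.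
Qed.
End Descent.

Section Functoriality.
Variables (G H : groupType) (f : G -> H).
Hypothesis fM : {morph f : x y / (x * y)%g}.

Lemma morph1g : f 1%g = 1%g.
Proof. by apply: (mulgI (f 1%g)); rewrite -fM !mulg1. Qed.

Lemma morphVg x : f x^-1%g = (f x)^-1%g.
Proof. by apply: (mulgI (f x)); rewrite -fM !mulgV morph1g. Qed.

Lemma subgroup_preimage (K : set H) : is_subgroup K -> is_subgroup (f @^-1` K).
Proof.
move=> [K1 KB]; split=> [|x y Kx Ky]; rewrite /preimage /mkset ?morph1g //.
by rewrite fM morphVg; apply: KB.
Qed.

Lemma lower_central_morph k :
  @lower_central G k `<=` f @^-1` @lower_central H k.
Proof.
elim: k => // -[//|k] IH.
rewrite lower_centralS //; apply: gen_subgroup_min.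
  exact/subgroup_preimage/subgroup_lower_central.
move=> _ [x [y [kx _ ->]]]; rewrite /preimage /mkset /commg /conjg !fM !morphVg.
by apply: (@commg_lower_central1 _ k.+1 (f x) (f y)); apply: IH.
Qed.

Lemma power_lower_central_morph k m :
  power_subgroup (@lower_central G k) m `<=`
  f @^-1` power_subgroup (@lower_central H k) m.
Proof.
apply: gen_subgroup_min; first exact/subgroup_preimage/subgroup_gen.
move=> _ [x kx <-]; apply: sub_gen_subgroup; exists (f x).
  exact: lower_central_morph.
elim: m => [|m IH]; first by rewrite !expg0 morph1g.
by rewrite !expgS fM IH.
Qed.

Lemma lower_central_prod_morph e n :
  lower_central_prod G e n `<=` f @^-1` lower_central_prod H e n.
Proof.
move=> _ [p pP <-]; rewrite /preimage /mkset (big_morph f fM morph1g).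
by exists (f \o p) => // i ni; apply: power_lower_central_morph; apply: pP.
Qed.
End Functoriality.

Section Letters.
Variables (X : choiceType) (m : nat) (s : m.-tuple X).
Hypothesis s_uniq : uniq s.

(** Restricting series along the injection [tnth s] on letters is
    multiplicative, since it maps the factorizations of a word onto those of
    its image; so it is enough to compare the two sides on letters and their
    inverses. *)
Lemma magnus_tnth (phi : free_group X -> free_group 'I_m) :
  {morph phi : x y / (x * y)%g} ->
  (forall i, phi (fg_gen (tnth s i)) = fg_gen i) ->
  (forall x, x \notin s -> phi (fg_gen x) = 1%g) ->
  forall g w, magnus int (phi g) w = magnus int g (map (tnth s) w).
Proof.
move=> phiM phi_in phi_out g.
have s_inj : injective (tnth s) by apply/tuple_uniqP.
have nil_map (w : seq 'I_m) : (map (tnth s) w == [::]) = (w == [::]) by case: w.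
have letterE (l : letter X) (w : seq 'I_m) :
    magnus int
      (phi (if l.2 then fg_gen l.1 else (fg_gen l.1)^-1)%g) w =
    mu_letter int l (map (tnth s) w).
  case: l => x b /=; have [/tnthP[i ->]|xs] := boolP (x \in s).
    have -> : phi (if b then fg_gen (tnth s i) else (fg_gen (tnth s i))^-1)%g =
              (if b then fg_gen i else (fg_gen i)^-1)%g.
      by case: b; rewrite ?(morphVg phiM) phi_in.
    case: b; rewrite /mu_letter /=.
      rewrite magnus_gen !ncs_addE !ncs_1E nil_map /=; congr (_ + _%:R).
      rewrite -[[:: tnth s i]]/(map (tnth s) [:: i]).
      by rewrite (inj_eq (inj_map s_inj)).
    rewrite /magnus big_seq1 /mu_letter /= /inv1var_coef all_map size_map.
    congr (if _ then _ else _); apply: eq_all => j /=.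
    by rewrite (inj_eq s_inj).
  have -> : phi (if b then fg_gen x else (fg_gen x)^-1)%g = 1%g.
    by case: b; rewrite ?(morphVg phiM) phi_out ?invg1.
  have xw : w != [::] -> all (pred1 x) (map (tnth s) w) = false.
    case: w => //= j w _; apply/negP => /andP[/eqP xE _].
    by case/negP: xs; rewrite -xE mem_tnth.
  rewrite magnus1 ncs_1E /mu_letter; case: b => /=.
    rewrite nil_map; case: w xw => //= j w /(_ isT).
    by rewrite eqseq_cons; case: eqP => //= _; case: (map _ w).
  rewrite /inv1var_coef; case: w xw => //= j w /(_ isT) ->; by [].
have {1}-> := fg_prodE g.
rewrite (big_morph phi phiM (morph1g phiM)).
rewrite (big_morph _ (@magnusM int 'I_m) (magnus1 int 'I_m)).
apply: (big_ind2 (fun (a : ncseries int 'I_m) (b : ncseries int X) =>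
  forall w, a w = b (map (tnth s) w))) => [w|a a' b b' ab ab' w|l _ w].
- by rewrite !ncs_1E nil_map.
- rewrite !ncs_mulE size_map; apply: eq_bigr => i _.
  by rewrite ab ab' map_take map_drop.
- exact: letterE.
Qed.
End Letters.

(** Only finitely many letters occur in [g]; sending the other letters to [1]
    retracts the problem to a free group on finitely many ordered letters. *)
Lemma magnus_filt_lower_central_prod (X : choiceType) e n :
  binomial_map e -> (1 <= n)%N ->
  magnus_filt int X e n `<=` lower_central_prod (free_group X) e n.
Proof.
move=> eb n1 g /(magnus_filt_coef_dvd eb.1) [_ gD].
pose s := in_tuple (undup (map fst (fg_word g))).
set m := size _ in s.
have s_uniq : uniq s by apply: undup_uniq.
have [phi [phiM phiX _]] := @fg_universal X (free_group 'I_m)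
  (fun x => if insub (index x s) is Some i then fg_gen i else 1%g).
have [psi [psiM psiX _]] := @fg_universal 'I_m (free_group X)
  (fun i => fg_gen (tnth s i)).
have phi_in i : phi (fg_gen (tnth s i)) = fg_gen i.
  rewrite phiX (tnth_nth (tnth s i)) index_uniq ?size_tuple //.
  by rewrite valK.
have phi_out x : x \notin s -> phi (fg_gen x) = 1%g.
  move=> xs; rewrite phiX insubF //; apply/negbTE.
  by rewrite -leqNgt memNindex // size_tuple.
have psi_phi : psi (phi g) = g.
  rewrite {1}[g]fg_prodE (big_morph phi phiM (morph1g phiM)).
  rewrite (big_morph psi psiM (morph1g psiM)) [RHS]fg_prodE.
  apply: eq_big_seq => -[x b] xg /=.
  have /tnthP[i ->] : x \in s by rewrite mem_undup; apply/mapP; exists (x, b).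
  by case: b xg => _; rewrite ?(morphVg phiM) phi_in ?(morphVg psiM) psiX.
rewrite -psi_phi; apply: (lower_central_prod_morph psiM).
apply: (coef_dvd_lower_central_prod eb n1).
split; first exact: magnus_val1.
move=> w wn; have w0 : w != [::] by rewrite -size_eq0 -lt0n; case/andP: wn.
rewrite magnus_sub1 // (magnus_tnth s_uniq phiM phi_in phi_out).
have ws : size (map (tnth s) w) = size w by rewrite size_map.
rewrite -ws -magnus_sub1 -?size_eq0 ?ws ?size_eq0 //.
by rewrite -ws; apply: gD; rewrite ws.
Qed.

Theorem theorem4p3 (X : choiceType) (e : nat -> nat -> nat) (n : nat) :
  binomial_map e -> (1 <= n)%N ->
  (forall R : comPzRingType,
     lower_central_prod (free_group X) e n `<=` group_algebra_filt R X e n /\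
     group_algebra_filt R X e n `<=` magnus_filt R X e n) /\
  (lower_central_prod (free_group X) e n = group_algebra_filt int X e n /\
   group_algebra_filt int X e n = magnus_filt int X e n).
Proof.
move=> eb n1.
have incl (R : comPzRingType) := conj
  (@lower_central_prod_group_algebra R X e n eb)
  (@group_algebra_filt_magnus R X e n).
have [LA AM] := incl int.
have ML := @magnus_filt_lower_central_prod X e n eb n1.
split; first exact: incl.
split; apply/seteqP; split=> //.
  exact: subset_trans AM ML.
exact: subset_trans ML LA.
Qed.
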